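(* Assume that $1\le p<p_1\le\infty$, $1\le q\le q_1\le\infty$ and $\alpha,\alpha_1\in\mathbb R$ such that $\alpha-\frac dp=\alpha_1-\frac d{p_1}$. Then we have the continuous inclusion $$B^\alpha_{p,q}(\mathbb T^d_\theta)\subset B^{\alpha_1}_{p_1,q_1}(\mathbb T^d_\theta).$$
   Context: Let $d\ge2$ and let $\theta=(\theta_{kj})$ be a real skew-symmetric $d\times d$ matrix. $\mathcal A_\theta$ is the universal C*-algebra generated by unitaries $U_1,\dots,U_d$ with $U_kU_j=e^{2\pi \mathrm i\theta_{kj}}U_jU_k$; put $U^m=U_1^{m_1}\cdots U_d^{m_d}$ for $m\in\mathbb Z^d$. $\tau$ is the faithful tracial state with $\tau(\sum_m\alpha_mU^m)=\alpha_0$ on polynomials (finite sums), and the quantum torus $\mathbb T^d_\theta$ is the w*-closure of $\mathcal A_\theta$ in the GNS representation of $\tau$. $L_p(\mathbb T^d_\theta)$ is the noncommutative $L_p$-space of $(\mathbb T^d_\theta,\tau)$ with norm $\|x\|_p=\tau(|x|^p)^{1/p}$, and $L_\infty(\mathbb T^d_\theta)=\mathbb T^d_\theta$. $\mathcal S(\mathbb T^d_\theta)=\{\sum_m a_mU^m:(a_m)\text{ rapidly decreasing}\}$ has derivations $\partial_j$ with $\partial_jU_j=2\pi\mathrm iU_j$, $\partial_jU_k=0$ ($k\ne j$), and is topologized by the norms $\sup_{|m|_1\le k}\|\partial_1^{m_1}\cdots\partial_d^{m_d}x\|_\infty$, $k\ge0$. Its topological dual $\mathcal S'(\mathbb T^d_\theta)$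 is the space of distributions, $L_p(\mathbb T_\theta^d)\subset\mathcal S'(\mathbb T_\theta^d)$ via $y\mapsto\tau(y\,\cdot)$, and $\widehat x(m)=\langle x,(U^m)^*\rangle$. Fix a Schwartz function $\varphi$ on $\mathbb R^d$ with $\operatorname{supp}\varphi\subset\{2^{-1}\le|\xi|\le2\}$, $\varphi>0$ on $\{2^{-1}<|\xi|<2\}$ and $\sum_{k\in\mathbb Z}\varphi(2^{-k}\xi)=1$ for $\xi\ne0$. Write $\widetilde\varphi_k*x=\sum_{m\in\mathbb Z^d}\varphi(2^{-k}m)\widehat x(m)U^m$. The Besov space $B^\alpha_{p,q}(\mathbb T^d_\theta)$ consists of all distributions $x$ with $\|x\|_{B^\alpha_{p,q}}=\big(|\widehat x(0)|^q+\sum_{k\ge0}2^{qk\alpha}\|\widetilde\varphi_k*x\|_p^q\big)^{1/q}<\infty$ (supremum if $q=\infty$). *)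

(* Defs.v *)
From HB Require Import structures.
From mathcomp Require Import all_boot all_order all_algebra.
From mathcomp Require Import all_classical all_reals all_analysis.
From mathcomp Require Import complex ring lra.

Set Implicit Arguments.
Unset Strict Implicit.
Unset Printing Implicit Defensive.
Import Order.TTheory GRing.Theory Num.Theory numFieldNormedType.Exports.

Local Open Scope classical_set_scope.
Local Open Scope complex_scope.
Local Open Scope ring_scope.

(* The GNS space of tau has the orthonormal basis (U^m)_{m in Z^d}, so it is
   l^2(Z^d), and an element x of the quantum torus is determined by the vector
   x 1, that is by its Fourier coefficients.  Elements of the quantum torus,
   of S(T_theta^d), and vectors of the GNS space are accordingly all
   represented by their coefficients: [a] stands for \sum_m a(m) U^m. *)
Definition qseries (R : realType) (d : nat) := 'rV[int]_d -> R[i].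

Section QuantumTorus.
Context {R : realType} {d : nat} (theta : 'M[R]_d).
Local Notation ser := (qseries R d).
Implicit Types (a b h : ser) (m n : 'rV[int]_d).

Definition expi (t : R) : R[i] := cos t +i* sin t.

(* U^m U^n = cocycle m n U^(m+n), with U^m = U_1^{m_1} ... U_d^{m_d}: each
   U_k^{m_k} has to be moved past the U_j^{n_j} with j < k. *)
Definition cocycle m n : R[i] :=
  expi (2 * pi * \sum_(k < d) \sum_(j < d | (j < k)%N)
                    theta k j * (m 0 k)%:~R * (n 0 j)%:~R).

Definition U m : ser := fun n => (n == m)%:R.

Definition gen (k : 'I_d) : ser := U (delta_mx 0 k).

(* Only meaningful when one of the factors is a polynomial, as it always is
   below: the sum is then finite. *)
Definition qmul a b : ser := fun k =>
  \sum_(n \in [set: 'rV[int]_d]) cocycle (k - n) n * a (k - n) * b n.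

(* (U^m)^* = (U^m)^{-1} = conj (cocycle m (-m)) U^(-m). *)
Definition star a : ser := fun n => ((cocycle (- n) n) * a (- n))^*.

Definition tau a : R[i] := a 0.

Definition polynomial a : Prop := finite_set [set m | a m != 0].

(* The GNS norm tau (a^* a)^(1/2). *)
Definition l2norm a : \bar R :=
  ((\esum_(m in [set: 'rV[int]_d]) (Normc.normc (a m) ^+ 2)%:E) `^ (2^-1))%E.

(* Norm of h |-> a h on the GNS space, in which polynomials are dense; this is
   the norm of the quantum torus. *)
Definition opnorm a : \bar R :=
  ereal_sup [set l2norm (qmul a h) |
             h in [set h | polynomial h /\ (l2norm h <= 1)%E]].

Definition qpow a (n : nat) : ser := iter n (qmul a) (U 0).

Definition qhorner (P : {poly R}) a : ser :=
  \sum_(i < size P) (P`_i)%:C *: qpow a i.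

(* Continuous functional calculus: b = f(a), for a a positive polynomial (whose
   spectrum lies in [0, ||a||]) and f continuous on [0, ||a||]. *)
Definition is_fun_calc (f : R -> R) a b : Prop :=
  exists P : nat -> {poly R},
    (forall e : R, 0 < e -> \forall n \near \oo,
       forall t : R, 0 <= t -> (t%:E <= opnorm a)%E -> `|(P n).[t] - f t| <= e)
    /\ (opnorm (qhorner (P n) a - b) @[n --> \oo] --> 0%E).

Definition fun_calc (f : R -> R) a : ser := xget 0 [set b | is_fun_calc f a b].

(* |a|^r = (a^* a)^(r/2) *)
Definition abs_pow a (r : R) : ser :=
  fun_calc (fun t => t `^ (r / 2)) (qmul (star a) a).

(* tau (|a|^p)^(1/p), for a polynomial a. *)
Definition Lp_norm (p : \bar R) a : \bar R :=
  match p with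
  | r%:E => ((complex.Re (tau (abs_pow a r))) `^ r^-1)%:E
  | +oo%E => opnorm a
  | -oo%E => 0%E
  end.

Definition rapidly_decreasing a : Prop :=
  forall N : nat, exists C : R, forall m,
    (1 + \sum_j `|(m 0 j)%:~R : R|) ^+ N * Normc.normc (a m) <= C.

(* The derivation with partial_j U_j = 2 pi i U_j and partial_j U_k = 0 for
   k != j satisfies partial_j U^m = 2 pi i m_j U^m. *)
Definition partial (j : 'I_d) a : ser :=
  fun m => (0 +i* (2 * pi * (m 0 j)%:~R)) * a m.

Definition partials (l : {ffun 'I_d -> nat}) a : ser :=
  foldr (fun j => iter (l j) (partial j)) a (enum 'I_d).

Definition schwartz_norm (k : nat) a : \bar R :=
  ereal_sup [set opnorm (partials l a) |
             l in [set l : {ffun 'I_d -> nat} | (\sum_j l j <= k)%N]].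

(* S'(T_theta^d), the dual of S(T_theta^d) for the topology of the norms
   schwartz_norm, neighbourhoods being given by a single norm since these
   increase with k; the values outside S(T_theta^d) are irrelevant. *)
Record qdistribution := QDistribution {
  pairing :> ser -> R[i];
  pairing_linear : forall (c : R[i]) a b,
    rapidly_decreasing a -> rapidly_decreasing b ->
    pairing (c *: a + b) = c * pairing a + pairing b;
  pairing_continuous : forall a, rapidly_decreasing a ->
    forall e : R, 0 < e -> exists (k : nat) (delta : R), 0 < delta /\
      forall b, rapidly_decreasing b -> (schwartz_norm k (b - a)%R < delta%:E)%E ->
        Normc.normc (pairing b - pairing a) < e }.

Definition fourier (x : qdistribution) : ser := fun m => x (star (U m)).

Lemma expiD s t : expi (s + t) = expi s * expi t.
Proof.
by apply/eqP; rewrite /expi cosD sinD eq_complex /= eqxx addrC eqxx.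
Qed.

Lemma qmulU m n : qmul (U m) (U n) = cocycle m n *: U (m + n).
Proof.
apply/funext => k; rewrite /qmul -(@fsbig_widen _ _ _ _ [set n]) //=; last first.
  by move=> i [_ /= /eqP ni]; rewrite /U (negbTE ni) mulr0.
rewrite fsbig_set1 /U eqxx mulr1 subr_eq.
rewrite -[RHS]/(cocycle m n * (k == m + n)%:R).
by have [->|] := eqVneq k (m + n); rewrite ?addrK // !mulr0.
Qed.

Lemma cocycle_gen k j :
  cocycle (delta_mx 0 k) (delta_mx 0 j) =
  expi (if (j < k)%N then 2 * pi * theta k j else 0).
Proof.
rewrite /cocycle (bigD1 k) //= [X in _ + X]big1 ?addr0; last first.
  move=> i ik; rewrite big1 // => l _.
  by rewrite mxE eqxx (negbTE ik) mulr0 mul0r.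
congr expi; case: ifPn => jk.
  rewrite (bigD1 j) //= big1 ?addr0 ?mxE ?eqxx ?mulr1 //.
  by move=> l /andP[_ lj]; rewrite !mxE (negbTE lj) andbF mulr0.
rewrite big1 ?mulr0 // => l lk; rewrite !mxE.
by have [lj|_] := eqVneq l j; rewrite ?andbF ?mulr0 // -lj lk in jk *.
Qed.

Lemma gen_comm (skew : theta^T = - theta) k j :
  qmul (gen k) (gen j) = expi (2 * pi * theta k j) *: qmul (gen j) (gen k).
Proof.
rewrite /gen !qmulU addrC scalerA !cocycle_gen -expiD; congr (expi _ *: _).
have E : theta j k = - theta k j.
  by have := congr1 (fun M : 'M[R]_d => M k j) skew; rewrite !mxE.
case: ltngtP => [||/ord_inj ejk].
- by rewrite addr0.
- by rewrite E mulrN subrr.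
- subst j; suff -> : theta k k = 0 by rewrite mulr0 addr0.
  lra.
Qed.

(* No phase appears in an ordered product, so U m is U_1^{m_1} ... U_d^{m_d}. *)
Lemma qmulU_ordered m n :
  (forall k j : 'I_d, (j < k)%N -> m 0 k = 0 \/ n 0 j = 0) ->
  qmul (U m) (U n) = U (m + n).
Proof.
move=> mn; rewrite qmulU /cocycle big1 ?mulr0; last first.
  move=> k _; rewrite big1 // => j /mn[] ->; first by rewrite mulr0 mul0r.
  by rewrite mulr0.
by rewrite /expi cos0 sin0 scale1r.
Qed.

Lemma starU m : star (U m) = (cocycle m (- m))^* *: U (- m).
Proof.
apply/funext => n; rewrite -[RHS]/((cocycle m (- m))^* * (n == - m)%:R).
rewrite /star /U eqr_oppLR; have [->|_] := eqVneq n (- m).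
  by rewrite opprK /= !mulr1.
by rewrite !mulr0 rmorph0.
Qed.

Lemma unitaryU m :
  qmul (star (U m)) (U m) = U 0 /\ qmul (U m) (star (U m)) = U 0.
Proof.
have mulcE (c : R[i]) a k : (c *: a) k = c * a k by [].
have qmulZl (c : R[i]) a b : qmul (c *: a) b = c *: qmul a b.
  apply/funext => k; rewrite mulcE /qmul mulr_fsumr.
  by apply: eq_fsbigr => n _; rewrite mulcE; ring.
have qmulZr (c : R[i]) a b : qmul a (c *: b) = c *: qmul a b.
  apply/funext => k; rewrite mulcE /qmul mulr_fsumr.
  by apply: eq_fsbigr => n _; rewrite mulcE; ring.
have expiC t : (expi t)^* * expi t = 1.
  apply/eqP; rewrite /expi eq_complex /= mulNr opprK -!expr2 cos2Dsin2 eqxx /=.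
  by rewrite mulNr mulrC subrr.
have cN : cocycle (- m) m = cocycle m (- m).
  rewrite /cocycle; congr (expi (_ * _)).
  apply: eq_bigr => k _; apply: eq_bigr => j _.
  by rewrite !mxE !rmorphN /= !mulrN mulNr.
rewrite starU qmulZl qmulZr !qmulU !scalerA addNr subrr cN expiC.
by split; rewrite scale1r.
Qed.

End QuantumTorus.

Section Besov.
Context {R : realType} {d : nat}.
Implicit Types (xi : 'rV[R]_d) (f : 'rV[R]_d -> R).

Definition enorm xi : R := Num.sqrt (\sum_j xi 0 j ^+ 2).

Definition iter_partial (js : seq 'I_d) f : 'rV[R]_d -> R :=
  foldr (fun j g => fun xi => 'D_(delta_mx 0 j) g xi) f js.

(* Differentiability of all iterated partial derivatives amounts to f being
   C^infinity. *)
Definition schwartz_function f : Prop :=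
  forall js : seq 'I_d,
    (forall xi, differentiable (iter_partial js f) xi) /\
    (forall N : nat, exists C : R, forall xi,
       (1 + enorm xi) ^+ N * `|iter_partial js f xi| <= C).

Definition dilate f (k : int) xi : R := f ((2 : R) ^ (- k) *: xi).

Definition dyadic_partition f : Prop :=
  [/\ schwartz_function f,
      closure [set xi | f xi != 0] `<=` [set xi | 2^-1 <= enorm xi <= 2],
      forall xi, 2^-1 < enorm xi < 2 -> 0 < f xi
    & forall xi, xi != 0 -> \sum_(k \in [set: int]) dilate f k xi = 1 ].

Variables (theta : 'M[R]_d) (phi : 'rV[R]_d -> R).

(* The polynomial \tilde phi_k * x. *)
Definition block (k : nat) (x : qdistribution theta) : qseries R d :=
  fun m => (dilate phi k (map_mx intr m))%:C * fourier x m.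

Definition besov_norm (alpha : R) (p q : \bar R) (x : qdistribution theta)
    : \bar R :=
  match q with
  | s%:E => (((Normc.normc (fourier x 0) `^ s)%:E +
      \sum_(0 <= k <oo) (2 `^ (s * k%:R * alpha))%:E *
                        Lp_norm theta p (block k x) `^ s) `^ s^-1)%E
  | +oo%E => maxe (Normc.normc (fourier x 0))%:E
      (ereal_sup (range (fun k : nat =>
         (2 `^ (k%:R * alpha))%:E * Lp_norm theta p (block k x))%E))
  | -oo%E => 0%E
  end.

Definition besov alpha p q : set (qdistribution theta) :=
  [set x | (besov_norm alpha p q x < +oo)%E].

End Besov.

Arguments besov {R d} theta phi alpha p q _.
Arguments besov_norm {R d} theta phi alpha p q x.

(* Main.v *)
Require Import Defs.
From HB Require Import structures.
From mathcomp Require Import all_boot all_order all_algebra.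
From mathcomp Require Import all_classical all_reals all_analysis.
From mathcomp Require Import complex ring lra zify.

(* The Nikolskii inequality |c|_p1 <= (D r^d)^(1/p - 1/p1) |c|_p, for a
   polynomial c with frequencies in the box [-r, r]^d, is proved with powers in
   place of Young's inequality.  Let a = c^* c and M = ||a||, so that
   tau (|c|^s) = tau (a^(s/2)).  If the power b = a^k is supported on N
   frequencies, then the operator norm of b is at most the square root of
   N tau (b^* b) = N tau (a^(2k)), whence, for k a power of 2,
     M^(2k) <= N tau (a^(2k)) <= N M^(2k - p/2) tau (|c|^p)    (p <= 4k),
   that is M^(p/2) <= N tau (|c|^p).  The case p1 = oo follows from
   ||c||^2 <= M, and the case p1 < oo from
   tau (|c|^p1) <= M^((p1 - p)/2) tau (|c|^p).
   Applied to the dyadic blocks, which have frequencies in a box of size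
   2^(k+1), the inequality reduces the theorem to the inclusion of l^q in l^q1.

   The functional calculus needs P(a) >= 0 for every polynomial P >= 0 on
   [0, M].  It is obtained from the expansion of P in Bernstein polynomials of
   large degree n: its coefficients are close to the values P(M k / n), and
   X^k (M - X)^(n - k) is a square times one of 1, X, M - X, X (M - X). *)

Set Implicit Arguments.
Unset Strict Implicit.
Unset Printing Implicit Defensive.
Import Order.TTheory GRing.Theory Num.Theory numFieldNormedType.Exports.

Local Open Scope classical_set_scope.
Local Open Scope complex_scope.
Local Open Scope ring_scope.

(** * Bernstein coefficients and positivity *)

(** Iteration of the absorption identity k C(n, k) = n C(n - 1, k - 1), one factor of the falling
    factorials at a time. *)
Lemma bin_ffact_shift (n k j : nat) : (j <= k <= n)%N ->
  ('C(n - j, k - j) * n ^_ j = 'C(n, k) * k ^_ j)%N.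
Proof.
elim: j n k => [|j IH] n k; first by rewrite !subn0 !ffactn0.
case: n => [|n]; first by rewrite leqn0 => /andP[/[swap]/eqP->].
case: k => [|k] // /IH; rewrite !subSS !ffactSS => E.
by rewrite mulnCA E mulnA (mul_bin_diag n.+1) -mulnA mulnCA.
Qed.

(** The ratio is the product of the factors (k - i) / (n - i), i < j, each in [0, 1] and within D /
    n of k / n, so the errors add up. When k < i, truncated subtraction makes the factor 0, and k /
    n is itself at most D / n. *)
Lemma ffact_ratio_approx (R : realType) (D n k j : nat) :
  (k <= n)%N -> (j <= D)%N -> (D <= n)%N ->
  let r : R := (k ^_ j)%:R / (n ^_ j)%:R in
  (0 <= r <= 1) /\ `|r - (k%:R / n%:R) ^+ j| <= (j * D)%:R / n%:R.
Proof.
move=> kn; elim: j => [|j IH] jD Dn /=.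
  by rewrite !ffactn0 expr0 divr1 subrr normr0 mul0n mul0r ler01 lexx.
have [/andP[r0 r1] IHd] := IH (ltnW jD) Dn.
have jn : (j < n)%N by apply: leq_trans Dn.
have n0 : 0 < n%:R :> R by rewrite ltr0n (leq_ltn_trans _ jn).
have nj0 : 0 < (n - j)%:R :> R by rewrite ltr0n subn_gt0.
have f0 : (n ^_ j)%:R != 0 :> R by rewrite pnatr_eq0 -lt0n ffact_gt0 ltnW.
rewrite !ffactnSr !natrM -mulf_div exprSr.
set r := (_ / _) in r0 r1 IHd *; set x := k%:R / n%:R.
set y := (k - j)%:R / (n - j)%:R.
have x01 : 0 <= x <= 1.
  by rewrite /x divr_ge0 // ler_pdivrMr // mul1r ler_nat.
have y01 : 0 <= y <= 1.
  by rewrite /y divr_ge0 // ler_pdivrMr // mul1r ler_nat leq_sub2r.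
have yx : `|y - x| <= D%:R / n%:R.
  rewrite ler_pdivlMr // -(gtr0_norm n0) -normrM mulrBl divfK ?gt_eqF //.
  have [kj|jk] := ltnP k j.
    rewrite /y (eqP (ltnW kj)) mul0r mul0r sub0r normrN ger0_norm // ler_nat.
    by rewrite (leq_trans (ltnW kj)) // ltnW.
  have -> : y * n%:R - k%:R = - (j%:R * ((n - k)%:R / (n - j)%:R)).
    rewrite /y !natrB ?(ltnW jn) // in nj0 *; field.
    by rewrite gt_eqF.
  rewrite normrN ger0_norm ?mulr_ge0 ?divr_ge0 //.
  apply: (@le_trans _ _ j%:R); last by rewrite ler_nat ltnW.
  by rewrite ler_piMr // ler_pdivrMr // mul1r ler_nat leq_sub2l.
split; first by apply/andP; split; nra.
have -> : r * y - x ^+ j * x = (r - x ^+ j) * x + r * (y - x) by ring.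
apply: (le_trans (ler_normD _ _)).
rewrite -natr1 (mulrDl j%:R) mul1r (mulrDl (_ * _)) -natrM.
rewrite lerD // normrM.
  apply: le_trans IHd; rewrite (ger0_norm (proj1 (andP x01))) ler_piMr //.
  by case/andP: x01.
by rewrite (ger0_norm r0); apply: le_trans yx; rewrite ler_piMl.
Qed.

(** Binomial expansion of the power in M^j X^j ((M - X) + X)^(n - j), with the index shifted by j.
    The terms k < j vanish together with [k ^_ j]. *)
Lemma bernstein_monomial (R : realType) (M : R) (n j : nat) : (j <= n)%N ->
  M ^+ n *: 'X^j = \sum_(k < n.+1) (M ^+ j *
    ('C(n, k)%:R * ((k ^_ j)%:R / (n ^_ j)%:R))) *:
     ('X ^+ k * (M%:P - 'X) ^+ (n - k)).
Proof.
move=> jn.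
have -> : M ^+ n *: 'X^j = M ^+ j *: ('X^j * ((M%:P - 'X) + 'X) ^+ (n - j)).
  rewrite subrK -polyC_exp mulrC mul_polyC scalerA -exprD subnKC //.
rewrite exprDn mulr_sumr scaler_sumr.
rewrite -(big_mkord xpredT (fun i => M ^+ j *: ('X^j *
  ((M%:P - 'X) ^+ (n - j - i) * 'X^i *+ 'C(n - j, i))))).
rewrite -(big_mkord xpredT (fun k => (M ^+ j *
  ('C(n, k)%:R * ((k ^_ j)%:R / (n ^_ j)%:R))) *:
   ('X ^+ k * (M%:P - 'X) ^+ (n - k)))).
rewrite [RHS](big_cat_nat (leq0n j)) /=; last exact: leqW.
rewrite [X in _ = X + _]big_nat [X in _ = X + _]big1 ?add0r; last first.
  by move=> k kj; rewrite ffact_small // mul0r !mulr0 scale0r.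
rewrite -[X in index_iota X n.+1]add0n big_addn subSn // !big_mkord.
apply: eq_bigr => i _.
have ijn : (j <= i + j <= n)%N.
  by rewrite leq_addl /= addnC -leq_subRL // -ltnS.
have f0 : (n ^_ j)%:R != 0 :> R by rewrite pnatr_eq0 -lt0n ffact_gt0.
have -> : 'C(n, i + j)%:R * (((i + j) ^_ j)%:R / (n ^_ j)%:R) =
   'C(n - j, i)%:R :> R.
  rewrite mulrA -natrM -(bin_ffact_shift ijn) natrM mulfK //.
  by rewrite addnK.
rewrite -scalerA; congr (_ *: _); rewrite -subnDA (addnC j) exprD.
by rewrite -mulr_natl -mul_polyC polyC_natr; ring.
Qed.

(** * Functionals on polynomials that are positive on [0, M] *)

Section Positivity.
Context {R : realType} (M : R) (L : {poly R} -> R).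
Hypotheses (M0 : 0 <= M) (linL : scalar L).
Hypothesis L_sqr : forall Q, 0 <= L (Q ^+ 2).
Hypothesis L_Xsqr : forall Q, 0 <= L ('X * Q ^+ 2).
Hypothesis L_MXsqr : forall Q, 0 <= L ((M%:P - 'X) * Q ^+ 2).

#[local] HB.instance Definition _ :=
  GRing.isLinear.Build R {poly R} R^o *%R L linL.

Let LZ c P : L (c *: P) = c * L P.
Proof. exact: linearZ. Qed.

Let LD P Q : L (P + Q) = L P + L Q.
Proof. exact: linearD. Qed.

Let LB P Q : L (P - Q) = L P - L Q.
Proof. exact: linearB. Qed.

Let L_sum n (F : 'I_n -> {poly R}) : L (\sum_(k < n) F k) = \sum_(k < n) L (F k).
Proof. exact: linear_sum. Qed.

(** Squares are split off according to the parities of k and l. The only case that is not a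
    hypothesis, X (M - X) Q^2, follows from M X (M - X) Q^2 = X ((M - X) Q)^2 + (M - X) (X Q)^2. *)
Lemma pos_functional_bernstein k l : 0 < M -> 0 <= L ('X ^+ k * (M%:P - 'X) ^+ l).
Proof.
move=> Mpos.
have L_both Q : 0 <= L ('X * (M%:P - 'X) * Q ^+ 2).
  rewrite -(pmulr_rge0 _ Mpos) -LZ.
  have -> : M *: ('X * (M%:P - 'X) * Q ^+ 2) =
    'X * ((M%:P - 'X) * Q) ^+ 2 + (M%:P - 'X) * ('X * Q) ^+ 2.
    rewrite -mul_polyC; ring.
  by rewrite LD addr_ge0.
rewrite -(odd_double_half k) -(odd_double_half l) !exprD -!muln2 !exprM.
set P := ('X ^+ k./2); set Q := ((_ - 'X) ^+ l./2).
have -> : 'X ^+ odd k * P ^+ 2 * ((M%:P - 'X) ^+ odd l * Q ^+ 2) =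
   'X ^+ odd k * (M%:P - 'X) ^+ odd l * (P * Q) ^+ 2 by ring.
by case: (odd k); case: (odd l); rewrite ?expr0 ?expr1 ?mul1r ?mulr1.
Qed.

Lemma bernstein_coefs (n : nat) (P : {poly R}) : (size P <= n)%N ->
  M ^+ n *: P = \sum_(k < n.+1) ('C(n, k)%:R *
     \sum_(j < size P) P`_j * M ^+ j * ((k ^_ j)%:R / (n ^_ j)%:R)) *:
     ('X ^+ k * (M%:P - 'X) ^+ (n - k)).
Proof.
move=> sPn.
rewrite -{1}[P]coefK poly_def scaler_sumr.
under eq_bigr => j _.
  rewrite scalerA mulrC -scalerA bernstein_monomial ?(leq_trans (ltnW (ltn_ord j))) //.
  rewrite scaler_sumr; over.
rewrite exchange_big /=; apply: eq_bigr => k _.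
rewrite mulr_sumr scaler_suml; apply: eq_bigr => j _.
by rewrite scalerA; congr (_ *: _); ring.
Qed.

(** [L] models P |-> <h, P(a) h> for an operator 0 <= a <= M. The Bernstein coefficients of P are at
    least - eps once the degree n is large, whence L P >= - eps L 1. *)
Lemma pos_functional_poly (P : {poly R}) :
  (forall t, 0 <= t <= M -> 0 <= P.[t]) -> 0 <= L P.
Proof.
move=> P0; have L1 : 0 <= L 1 by rewrite -[1](expr1n _ 2).
(* For M = 0 the hypotheses on X Q^2 and (M - X) Q^2 force L (X Q^2) = 0, then L (X Q) = 0 by
   polarization, and only P(0) L 1 remains of L P. *)
have [M00|Mn0] := eqVneq M 0.
  have LX2 Q : L ('X * Q ^+ 2) = 0.
    apply/eqP; rewrite eq_le L_Xsqr andbT -oppr_ge0 -mulN1r -LZ scaleN1r.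
    by have := L_MXsqr Q; rewrite M00 sub0r mulNr.
  have LX Q : L ('X * Q) = 0.
    have -> : 'X * Q = 4^-1 *: ('X * (Q + 1) ^+ 2 - 'X * (Q - 1) ^+ 2).
      have -> : 'X * (Q + 1) ^+ 2 - 'X * (Q - 1) ^+ 2 = 4%:R *: ('X * Q).
        by rewrite scaler_nat; ring.
      by rewrite scalerA mulVf ?scale1r // pnatr_eq0.
    by rewrite LZ LB !LX2 subrr mulr0.
  have /factor_theorem[Q PQ] : root (P - P.[0]%:P) 0.
    by rewrite /root !hornerE subrr.
  rewrite -(subrK P.[0]%:P P) PQ subr0 mulrC LD LX add0r.
  by rewrite -alg_polyC LZ mulr_ge0 // P0 // M00 lexx.
have Mpos : 0 < M by rewrite lt_def Mn0.
apply/ler_addgt0Pl => e e0; rewrite -lerBlDl sub0r.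
pose D := size P; pose S := \sum_(j < D) `|P`_j| * M ^+ j.
have S0 : 0 <= S by apply: sumr_ge0 => j _; rewrite mulr_ge0 ?exprn_ge0.
(* Adding 1 keeps the denominator positive, and still eps L 1 <= e. *)
pose eps := e / (L 1 + 1); have eps0 : 0 < eps by rewrite divr_gt0 // ltr_wpDl.
(* The coefficient errors add up to at most S D^2 / n, which this n brings below eps. *)
pose n := maxn D (Num.truncn (S * (D * D)%:R / eps)).+1.
have Dn : (D <= n)%N by rewrite leq_maxl.
have n0 : 0 < n%:R :> R by rewrite ltr0n leq_max orbT.
have Sn : S * ((D * D)%:R / n%:R) <= eps.
  rewrite mulrA ler_pdivrMr // (mulrC eps) -ler_pdivrMr // ltW //.
  apply: (lt_le_trans (truncnS_gt _)); by rewrite ler_nat leq_maxr.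
pose beta k := L ('X ^+ k * (M%:P - 'X) ^+ (n - k)).
have beta0 k : 0 <= beta k by exact: pos_functional_bernstein.
have coef_ge (k : 'I_n.+1) :
    - eps <= \sum_(j < D) P`_j * M ^+ j * ((k ^_ j)%:R / (n ^_ j)%:R).
  have kn : (k <= n)%N by rewrite -ltnS.
  have : 0 <= P.[M * (k%:R / n%:R)].
    apply: P0; rewrite mulr_ge0 ?divr_ge0 //=.
    by rewrite ler_piMr // ler_pdivrMr // mul1r ler_nat.
  rewrite horner_coef => H; rewrite -[leLHS]addr0.
  rewrite -[leRHS](subrK (\sum_(i < D) P`_i * (M * (k%:R / n%:R)) ^+ i)).
  apply: lerD => //; rewrite lerNl opprB -sumrB.
  apply: le_trans Sn; rewrite mulr_suml; apply: ler_sum => j _.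
  rewrite exprMn; set r := (_ / (n ^_ j)%:R).
  have [_ Hr] := ffact_ratio_approx R kn (ltnW (ltn_ord j)) Dn.
  have -> : P`_j * (M ^+ j * (k%:R / n%:R) ^+ j) - P`_j * M ^+ j * r =
    - (P`_j * M ^+ j * (r - (k%:R / n%:R) ^+ j)) by ring.
  apply: (le_trans (ler_norm _)).
  rewrite normrN !normrM (ger0_norm (exprn_ge0 _ M0)).
  apply: ler_wpM2l; first by rewrite mulr_ge0 ?exprn_ge0.
  apply: (le_trans Hr); rewrite ler_wpM2r ?invr_ge0 // ler_nat.
  by rewrite leq_mul2r ltnW ?orbT.
(* The constant 1 has all its Bernstein coefficients equal to 1, so the bound - eps on the
   coefficients of P sums to - eps M^n L 1. *)
have one : M ^+ n * L 1 = \sum_(k < n.+1) 'C(n, k)%:R * beta k.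
  rewrite -LZ -mul_polyC mulr1 polyC_exp -{1}(subrK 'X M%:P) exprDn L_sum.
  apply: eq_bigr => k _; rewrite mulrC -mulr_natl -polyC_natr mul_polyC.
  by rewrite LZ.
have LP : - eps * (M ^+ n * L 1) <= M ^+ n * L P.
  rewrite one -LZ (bernstein_coefs Dn) L_sum mulr_sumr.
  apply: ler_sum => k _; rewrite LZ /= -/(beta k) mulrA.
  rewrite ler_wpM2r // mulrC ler_wpM2l //; exact: coef_ge.
have : - eps * L 1 <= L P.
  by rewrite -(ler_pM2l (exprn_gt0 n Mpos)) mulrCA.
apply: le_trans; rewrite mulNr lerN2 /eps -mulrA ler_piMr ?(ltW e0) //.
by rewrite mulrC ler_pdivrMr ?ltr_wpDl // mul1r lerDl.
Qed.
End Positivity.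

(** * Weierstrass approximation of powers *)

Section Weierstrass.
Context {R : realType}.

Let B (n k : nat) (t : R) := 'C(n, k)%:R * (t ^+ k * (1 - t) ^+ (n - k)).

Let B_ge0 n k t : 0 <= t <= 1 -> 0 <= B n k t.
Proof. by move=> /andP[t0 t1]; rewrite !mulr_ge0 // exprn_ge0 // subr_ge0. Qed.

(** These are the factorial moments of the binomial law, read off from [bernstein_monomial] with M =
    1 at the point t. *)
Let B_ffact n j t : (j <= n)%N ->
  \sum_(k < n.+1) (k ^_ j)%:R / (n ^_ j)%:R * B n k t = t ^+ j.
Proof.
move=> jn; have := congr1 (fun P => P.[t]) (bernstein_monomial 1 jn).
rewrite /= expr1n scale1r hornerXn => ->; rewrite horner_sum.
apply: eq_bigr => k _; rewrite expr1n mul1r hornerZ hornerM horner_exp hornerX.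
by rewrite horner_exp hornerD hornerN hornerX hornerC /B; ring.
Qed.

(** Writing k^2 = k (k - 1) + k reduces the variance to the factorial moments of orders 0, 1 and 2;
    its exact value is t (1 - t) / n. The moment of order 2 divides by n (n - 1), whence 1 < n. *)
Lemma bernstein_variance n (t : R) : (1 < n)%N -> 0 <= t <= 1 ->
  \sum_(k < n.+1) (k%:R / n%:R - t) ^+ 2 *
    ('C(n, k)%:R * (t ^+ k * (1 - t) ^+ (n - k))) <= n%:R^-1.
Proof.
move=> n1 t01; have n0 : n%:R != 0 :> R by rewrite pnatr_eq0; case: n n1.
have E2 k : (k ^_ 2)%:R = k%:R * (k%:R - 1) :> R.
  case: k => [|k]; first by rewrite mul0r.
  by rewrite ffactSS ffactn1 natrM -natr1 addrK.
have -> : \sum_(k < n.+1) (k%:R / n%:R - t) ^+ 2 * B n k t =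
   (n%:R - 1) / n%:R * t ^+ 2 + (n%:R^-1 - 2 * t) * t ^+ 1 + t * t * t ^+ 0.
  rewrite -(B_ffact t n1) -(B_ffact t (ltnW n1)).
  rewrite -[in X in _ = _ + X](B_ffact t (leq0n n)).
  rewrite !mulr_sumr -!big_split /=; apply: eq_bigr => k _.
  rewrite !ffactn0 !ffactn1 !E2; field; rewrite n0 /=.
  by rewrite subr_eq0 -[1]/(1%:R) eqr_nat; move: n1;
     rewrite ltn_neqAle eq_sym => /andP[].
have -> : (n%:R - 1) / n%:R * t ^+ 2 + (n%:R^-1 - 2 * t) * t ^+ 1 + t * t * t ^+ 0
  = t * (1 - t) / n%:R by field.
by rewrite ler_piMl ?invr_ge0 //; nra.
Qed.

(** Chebyshev's argument: averaging the quadratic modulus of continuity against the binomial weights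
    turns C (x - t)^2 into C / n by the variance bound. *)
Lemma bernstein_approx (f : R -> R) (C e : R) : 0 < e -> 0 <= C ->
  (forall x t, 0 <= x <= 1 -> 0 <= t <= 1 ->
     `|f x - f t| <= e + C * (x - t) ^+ 2) ->
  exists P : {poly R}, forall t, 0 <= t <= 1 -> `|P.[t] - f t| <= 2 * e.
Proof.
(* This gives C / n <= e, and n >= 2 as required by the variance bound. *)
move=> e0 C0 Hf; pose n := (Num.truncn (C / e)).+2.
have n0 : 0 < n%:R :> R by rewrite ltr0n.
exists (\sum_(k < n.+1) f (k%:R / n%:R) *:
  ('C(n, k)%:R *: ('X^k * (1 - 'X) ^+ (n - k)))).
move=> t t01; rewrite horner_sum.
have B1 : \sum_(k < n.+1) B n k t = 1.
  rewrite -[RHS](expr0 t) -(B_ffact t (leq0n n)); apply: eq_bigr => k _.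
  by rewrite !ffactn0 divr1 mul1r.
have -> : f t = \sum_(k < n.+1) f t * B n k t by rewrite -mulr_sumr B1 mulr1.
rewrite -sumrB.
apply: (@le_trans _ _ (\sum_(k < n.+1) (e * B n k t +
     C * ((k%:R / n%:R - t) ^+ 2 * B n k t)))).
  apply: (le_trans (ler_norm_sum _ _ _)); apply: ler_sum => k _.
  rewrite !hornerZ hornerM hornerXn horner_exp.
  rewrite hornerD hornerN hornerX hornerC -/(B n k t).
  rewrite -mulrBl normrM (ger0_norm (B_ge0 _ _ t01)) (mulrA C) -mulrDl.
  apply: ler_wpM2r; first exact: B_ge0.
  apply: Hf => //; rewrite divr_ge0 //= ler_pdivrMr // mul1r ler_nat -ltnS.
  exact: ltn_ord.
rewrite big_split /= -!mulr_sumr B1 mulr1 mulr2n mulrDl !mul1r lerD2l.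
apply: (@le_trans _ _ (C / n%:R)); first by rewrite ler_wpM2l // bernstein_variance.
rewrite ler_pdivrMr // mulrC -ler_pdivrMr // ltW // (lt_trans (truncnS_gt _)) //.
by rewrite ltr_nat.
Qed.

(** Young's inequality for y and 1 with the conjugate exponents r and r / (r - 1). *)
Lemma powR_Bernoulli (y r : R) : 0 <= y -> 1 <= r -> 1 + r * (y - 1) <= y `^ r.
Proof.
move=> y0; rewrite le_eqVlt => /predU1P[<-|r1].
  by rewrite powRr1 // mul1r; lra.
have r0 : 0 < r by lra.
have rn0 : r != 0 by rewrite gt_eqF.
have q0 : 0 < r / (r - 1) by rewrite divr_gt0 // subr_gt0.
have := @conjugate_powR R y 1 r (r / (r - 1)) y0 ler01 r0 q0.
rewrite powR1 mulr1 mul1r !invf_div => /(_ _)/wrap[]; first by field.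
by rewrite -(ler_pM2r r0) mulrDl !divfK //; lra.
Qed.

(** Bernoulli's inequality at y / x gives x^r - y^r <= x^r r (1 - y / x), and x^r <= x because x <=
    1 <= r. *)
Lemma powR_lipschitz (x y r : R) : 0 <= y <= x -> x <= 1 -> 1 <= r ->
  x `^ r - y `^ r <= r * (x - y).
Proof.
move=> /andP[y0 yx] x1 r1; have r0 : r != 0 by rewrite gt_eqF //; lra.
have [x0|x0] := eqVneq x 0.
  by rewrite (_ : y = x) ?subrr ?mulr0 //; apply: le_anti; rewrite yx x0.
have xp : 0 < x by rewrite lt_def x0 (le_trans y0).
have yE : y = x * (y / x) by rewrite mulrCA divff // mulr1.
have q0 : 0 <= y / x by rewrite divr_ge0 // ltW.
have H := powR_Bernoulli q0 r1.
rewrite {1}yE powRM ?(ltW xp) // .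
have xr : x `^ r <= x by rewrite ge1r_powR ?xp.
have xr0 := powR_ge0 x r.
have q1 : y / x <= 1 by rewrite ler_pdivrMr // mul1r.
have -> : r * (x - y) = x * (r * (1 - y / x)) by field.
apply: (@le_trans _ _ (x `^ r * (r * (1 - y / x)))).
  rewrite -[X in X - _]mulr1 -mulrBr ler_wpM2l //; lra.
rewrite ler_wpM2r // mulr_ge0 ?subr_ge0 //; lra.
Qed.

(** Since t^(r/2) = (sqrt t)^r, the Lipschitz bound applies to the square roots, and |sqrt x - sqrt
    t| <= sqrt |x - t|. *)
Lemma half_powR_modulus (x t r : R) : 0 <= x <= 1 -> 0 <= t <= 1 -> 1 <= r ->
  `|x `^ (r / 2) - t `^ (r / 2)| <= r * Num.sqrt `|x - t|.
Proof.
wlog tx : x t / t <= x => [H x01 t01 r1|].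
  have [tx|/ltW xt] := leP t x; first exact: H.
  by rewrite distrC (distrC x); exact: H.
move=> /andP[x0 x1] /andP[t0 t1] r1.
have sE (u : R) : 0 <= u -> u `^ (r / 2) = (Num.sqrt u) `^ r.
  by move=> u0; rewrite mulrC powRrM powR12_sqrt.
have s_tx : Num.sqrt t <= Num.sqrt x by rewrite ler_wsqrtr.
rewrite !sE // !ger0_norm ?subr_ge0 //; last first.
  by rewrite ge0_ler_powR ?nnegrE ?sqrtr_ge0 //; lra.
apply: le_trans (powR_lipschitz _ _ r1) _.
- by rewrite sqrtr_ge0.
- by rewrite -[leRHS]sqrtr1 ler_wsqrtr.
rewrite ler_wpM2l //; first lra.
have st0 := sqrtr_ge0 t; have sx0 := sqrtr_ge0 x.
rewrite -(ler_pXn2r (n:=2)) ?nnegrE ?sqrtr_ge0 ?subr_ge0 //.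
rewrite sqr_sqrtr ?subr_ge0 // -{2}(sqr_sqrtr x0) -{2}(sqr_sqrtr t0); nra.
Qed.

Lemma weierstrass_half_powR (r M e : R) : 1 <= r -> 0 <= M -> 0 < e ->
  exists P : {poly R}, forall t, 0 <= t <= M -> `|P.[t] - t `^ (r / 2)| <= e.
Proof.
move=> r1 M0 e0; have r2 : r / 2 != 0 by rewrite gt_eqF //; lra.
have r0 : 0 < r by lra.
have [M00|Mn0] := eqVneq M 0.
  exists 0 => t /andP[t0]; rewrite M00 => t0'; have -> : t = 0 by lra.
  by rewrite horner0 powR0 // subrr normr0 ltW.
have Mp : 0 < M by rewrite lt_def Mn0.
have Mr : 0 < M `^ (r / 2) by rewrite powR_gt0.
(* The factor M^(r/2) is lost in rescaling [0, M] to [0, 1], the factor 2 in [bernstein_approx]. *)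
pose e1 := e / M `^ (r / 2) / 2; have e10 : 0 < e1 by rewrite !divr_gt0.
(* With u = sqrt |x - t|, one has r u <= r d + (r / d^3) u^4: the first term suffices for u <= d,
   the second for u >= d. Here r d = e1 and u^4 = (x - t)^2. *)
pose d := e1 / r; have d0 : 0 < d by rewrite divr_gt0.
have [|x t x01 t01|P HP] :=
  @bernstein_approx (fun t => t `^ (r / 2)) (r / d ^+ 3) e1 e10.
- by rewrite divr_ge0 ?exprn_ge0 // ltW.
- apply: le_trans (half_powR_modulus x01 t01 r1) _.
  set u := Num.sqrt _; have u0 : 0 <= u by exact: sqrtr_ge0.
  have -> : (x - t) ^+ 2 = u ^+ 4.
    by rewrite (exprM _ 2 2) sqr_sqrtr // real_normK // num_real.
  have e1E : e1 = r * d by rewrite /d mulrCA divff ?mulr1 // gt_eqF.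
  rewrite e1E -mulrA -mulrDr ler_pM2l //.
  have [ud|/ltW du] := leP u d.
    by rewrite ler_wpDr // mulr_ge0 ?invr_ge0 ?exprn_ge0 // ltW.
  rewrite ler_wpDl ?(ltW d0) // mulrC ler_pdivlMr ?exprn_gt0 //.
  by rewrite (exprS u 3) ler_wpM2l // lerXn2r // nnegrE ltW.
exists (M `^ (r / 2) *: (P \Po (M^-1 *: 'X))) => t /andP[t0 tM].
have q01 : 0 <= t / M <= 1 by rewrite divr_ge0 //= ler_pdivrMr // mul1r.
have -> : t `^ (r / 2) = M `^ (r / 2) * (t / M) `^ (r / 2).
  by rewrite -powRM ?(ltW Mp) ?(proj1 (andP q01)) // mulrCA divff // mulr1.
rewrite hornerZ horner_comp hornerZ hornerX (mulrC M^-1) -mulrBr normrM.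
rewrite gtr0_norm // -ler_pdivlMl //; apply: le_trans (HP _ q01) _.
by rewrite /e1 mulrC divfK ?pnatr_eq0 // mulrC.
Qed.
End Weierstrass.

(** * The algebra of polynomials *)

Section ComplexDot.
Context {R : realType}.
Implicit Types (x y z : R[i]).

(** The inner product of the real plane R[i]; the GNS space is treated below as a real Hilbert
    space. *)
Definition rdot x y : R := complex.Re (x^* * y).

Lemma rdotE x y : rdot x y = complex.Re x * complex.Re y + complex.Im x * complex.Im y.
Proof. by case: x y => [a b] [c d]; rewrite /rdot /= mulNr opprK. Qed.

Lemma rdotC x y : rdot x y = rdot y x.
Proof. by rewrite !rdotE; ring. Qed.

Lemma rdotDr x y z : rdot x (y + z) = rdot x y + rdot x z.
Proof. by case: x y z => [a b] [c d] [e f]; rewrite !rdotE /=; ring. Qed.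

Lemma rdotZr (t : R) x y : rdot x (t%:C * y) = t * rdot x y.
Proof. by case: x y => [a b] [c d]; rewrite !rdotE /=; ring. Qed.

Lemma rdot_sumr (I : Type) (s : seq I) x (F : I -> R[i]) :
  rdot x (\sum_(i <- s) F i) = \sum_(i <- s) rdot x (F i).
Proof.
elim/big_rec2: _ => [|i u v _ <-]; first by rewrite rdotE /= !mulr0 addr0.
by rewrite rdotDr.
Qed.

Lemma rdot_normc x : rdot x x = Normc.normc x ^+ 2.
Proof.
by case: x => [a b]; rewrite rdotE /= sqr_sqrtr ?addr_ge0 ?sqr_ge0 // !expr2.
Qed.

Lemma rdot_ge0 x : 0 <= rdot x x.
Proof. by rewrite rdot_normc sqr_ge0. Qed.

Lemma rdot_conj x y z : rdot (x * y) z = rdot y (x^* * z).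
Proof. by rewrite /rdot rmorphM /= mulrA (mulrC _ y^*). Qed.

Lemma expi_conj (t : R) : (expi t)^* = expi (- t).
Proof. by rewrite /expi cosN sinN. Qed.

Lemma expi0 : expi 0 = 1 :> R[i].
Proof. by rewrite /expi cos0 sin0. Qed.

Lemma expi_conjM (t : R) : (expi t)^* * expi t = 1.
Proof. by rewrite expi_conj -expiD addNr expi0. Qed.
End ComplexDot.

(** * Twisted convolution, adjoints and the GNS inner product *)

Section TwistedAlgebra.
Context {R : realType} {d : nat} (theta : 'M[R]_d).
Local Notation ser := (qseries R d).
Local Notation zd := 'rV[int]_d.
Implicit Types (a b g h : ser) (m n k : zd) (s t : seq zd).
Local Notation c := (cocycle theta).
Local Notation qmul := (qmul theta).
Local Notation polynomial := Defs.polynomial.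

(** The cocycle is the exponential of a bilinear form, hence a bicharacter of modulus one; the
    identities below all come from this. *)
Lemma cocycleDl m m' n : c (m + m') n = c m n * c m' n.
Proof.
rewrite /cocycle -expiD -mulrDr -big_split /=; congr (expi (_ * _)).
apply: eq_bigr => k _; rewrite -big_split /=; apply: eq_bigr => j _.
by rewrite !mxE rmorphD /= !mulrDr !mulrDl.
Qed.

Lemma cocycleDr m n n' : c m (n + n') = c m n * c m n'.
Proof.
rewrite /cocycle -expiD -mulrDr -big_split /=; congr (expi (_ * _)).
apply: eq_bigr => k _; rewrite -big_split /=; apply: eq_bigr => j _.
by rewrite !mxE rmorphD /= !mulrDr.
Qed.

Lemma cocycle_conjM m n : (c m n)^* * c m n = 1.
Proof. exact: expi_conjM. Qed.

Lemma cocycle_neq0 m n : c m n != 0.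
Proof.
by have := oner_neq0 R[i]; rewrite -(cocycle_conjM m n) mulf_eq0 negb_or => /andP[].
Qed.

Lemma cocycle0r m : c m 0 = 1.
Proof.
apply: (mulIf (cocycle_neq0 m 0)).
by rewrite -cocycleDr addr0 mul1r.
Qed.

Lemma cocycle0l m : c 0 m = 1.
Proof.
apply: (mulIf (cocycle_neq0 0 m)).
by rewrite -cocycleDl addr0 mul1r.
Qed.

Lemma cocycleNl m n : c (- m) n = (c m n)^*.
Proof.
apply: (mulIf (cocycle_neq0 m n)).
by rewrite cocycle_conjM -cocycleDl addNr cocycle0l.
Qed.

Lemma cocycleNr m n : c m (- n) = (c m n)^*.
Proof.
apply: (mulIf (cocycle_neq0 m n)).
by rewrite cocycle_conjM -cocycleDr addNr cocycle0r.
Qed.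

Lemma serD a b m : (a + b) m = a m + b m. Proof. by []. Qed.

Lemma serZ (x : R[i]) a m : (x *: a) m = x * a m. Proof. by []. Qed.

(** An explicit list of frequencies turns the sums over Z^d into ordinary finite sums. *)
Definition supp_in s a := forall m, m \notin s -> a m = 0.

Lemma polynomialP a : polynomial a <-> exists2 s, uniq s & supp_in s a.
Proof.
split=> [/finite_seqP[s sE]|[s us sa]].
  exists (undup s); first exact: undup_uniq.
  move=> m; rewrite mem_undup => ms; apply/eqP; apply: contraNT ms => am.
  suff : [set` s] m by [].
  by rewrite -sE.
apply/finite_seqP; exists [seq m <- s | a m != 0].
apply/seteqP; split => m /=; rewrite mem_filter; last by case/andP.
by move=> am; rewrite am; apply: contraNT am => /sa ->.
Qed.

Lemma supp_in_sub s t a : {subset s <= t} -> supp_in s a -> supp_in t a.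
Proof. by move=> st sa m mt; apply: sa; apply: contraNN mt; exact: st. Qed.

Lemma polynomial2P a b : polynomial a -> polynomial b ->
  exists s, [/\ uniq s, supp_in s a & supp_in s b].
Proof.
move=> /polynomialP[s us sa] /polynomialP[t ut tb].
exists (undup (s ++ t)); split; first exact: undup_uniq.
  by apply: supp_in_sub sa => m; rewrite mem_undup mem_cat => ->.
by apply: supp_in_sub tb => m; rewrite mem_undup mem_cat orbC => ->.
Qed.

Lemma polynomialZD (x : R[i]) a b :
  polynomial a -> polynomial b -> polynomial (x *: a + b).
Proof.
move=> pa pb; have [s [us sa sb]] := polynomial2P pa pb.
apply/polynomialP; exists s => // m ms.
by rewrite serD serZ sa // sb // mulr0 addr0.
Qed.

Lemma polynomial0 : polynomial (0 : ser).
Proof. by apply/polynomialP; exists [::]. Qed.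

Lemma polynomialZ (x : R[i]) a : polynomial a -> polynomial (x *: a).
Proof.
move=> pa; rewrite -[_ *: _]addr0; apply: polynomialZD => //.
exact: polynomial0.
Qed.

Lemma polynomialD a b : polynomial a -> polynomial b -> polynomial (a + b).
Proof. by move=> pa pb; rewrite -[a]scale1r; exact: polynomialZD. Qed.

Lemma polynomial_sum (I : Type) (r : seq I) (F : I -> ser) :
  (forall i, polynomial (F i)) -> polynomial (\sum_(i <- r) F i).
Proof.
move=> pF; elim/big_rec: _ => [|i a _ pa]; first exact: polynomial0.
exact: polynomialD.
Qed.

Lemma polynomialU m : polynomial (U m : ser).
Proof.
apply/polynomialP; exists [:: m] => // n; rewrite inE /U => /negbTE ->.
by [].
Qed.

Lemma fsum_supp (T : zmodType) s (F : zd -> T) : uniq s ->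
  (forall m, m \notin s -> F m = 0) ->
  \sum_(m \in [set: zd]) F m = \sum_(m <- s) F m.
Proof.
move=> us sF; rewrite (@fsbigE _ _ _ _ _ s) //; last by move=> m _; exact: sF.
by apply: eq_bigl => m; exact: mem_set.
Qed.

(** Both sides are the sum of F over all of Z^d, which is invariant under translation. *)
Lemma sum_supp_shift (T : zmodType) s t (F : zd -> T) m : uniq s -> uniq t ->
  (forall n, n \notin s -> F n = 0) -> (forall n, n \notin t -> F (n + m) = 0) ->
  \sum_(n <- s) F n = \sum_(n <- t) F (n + m).
Proof.
move=> us ut sF tF; rewrite -(fsum_supp us sF).
rewrite -(big_map (fun n => n + m) xpredT F) -fsum_supp //.
  by rewrite map_inj_uniq //; exact: addIr.
move=> n nt; rewrite -(subrK m n); apply: tF; apply: contraNN nt => nt.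
by apply/mapP; exists (n - m) => //; rewrite subrK.
Qed.

Lemma qmulE s a h k : uniq s -> supp_in s h ->
  qmul a h k = \sum_(n <- s) c (k - n) n * a (k - n) * h n.
Proof. by move=> us sh; apply: fsum_supp => // m /sh ->; rewrite mulr0. Qed.

Lemma supp_in_qmul s t a h : uniq t -> supp_in s a -> supp_in t h ->
  supp_in [seq m + n | m <- s, n <- t] (qmul a h).
Proof.
move=> ut sa th k kst; rewrite (qmulE _ _ ut th) big_seq big1 // => n nt.
rewrite sa ?mulr0 ?mul0r //; apply: contraNN kst => kn.
by rewrite -(subrK n k); apply/allpairsP; exists (k - n, n).
Qed.

Lemma polynomial_qmul a h : polynomial a -> polynomial h -> polynomial (qmul a h).
Proof.
move=> /polynomialP[s us sa] /polynomialP[t ut th].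
apply/polynomialP; exists (undup [seq m + n | m <- s, n <- t]).
  exact: undup_uniq.
apply: supp_in_sub (supp_in_qmul ut sa th) => m; by rewrite mem_undup.
Qed.

Lemma polynomial_star a : polynomial a -> polynomial (star theta a).
Proof.
move=> /polynomialP[s us sa]; apply/polynomialP; exists [seq - m | m <- s].
  by rewrite map_inj_uniq //; exact: oppr_inj.
move=> m ms; rewrite /star sa ?mulr0 ?rmorph0 //; apply: contraNN ms => ms.
by apply/mapP; exists (- m); rewrite ?opprK.
Qed.

Lemma qmulZDr (x : R[i]) a g h : polynomial g -> polynomial h ->
  qmul a (x *: g + h) = x *: qmul a g + qmul a h.
Proof.
move=> pg ph; have [s [us sg sh]] := polynomial2P pg ph.
apply/funext => k; rewrite serD serZ.
rewrite (qmulE _ _ us sg) (qmulE _ _ us sh) (@qmulE s) //; last first.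
  by move=> m ms; rewrite serD serZ sg // sh // mulr0 addr0.
rewrite mulr_sumr -big_split /=; apply: eq_bigr => n _.
by rewrite serD serZ; ring.
Qed.

Lemma qmulZDl (x : R[i]) a b h : polynomial h ->
  qmul (x *: a + b) h = x *: qmul a h + qmul b h.
Proof.
move=> /polynomialP[s us sh]; apply/funext => k.
rewrite serD serZ.
rewrite !(qmulE _ _ us sh) mulr_sumr -big_split /=; apply: eq_bigr => n _.
by rewrite serD serZ; ring.
Qed.

(** After the change of index k = m + n the phases agree by bilinearity of the cocycle. *)
Lemma qmulA a b h : polynomial b -> polynomial h ->
  qmul (qmul a b) h = qmul a (qmul b h).
Proof.
move=> pb ph; have pbh := polynomial_qmul pb ph.
move: pb ph pbh => /polynomialP[s us sb] /polynomialP[t ut th] /polynomialP[r ur rbh].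
apply/funext => l; rewrite (qmulE _ _ ut th) (qmulE _ _ ur rbh).
(* The support of b h is enlarged by all sums of a frequency of b and one of h, so that the change
   of index k = m + n stays inside it. *)
pose r' := undup (r ++ [seq m + n | m <- s, n <- t]).
have ur' : uniq r' by exact: undup_uniq.
have r'bh : supp_in r' (qmul b h).
  by apply: supp_in_sub rbh => m; rewrite mem_undup mem_cat => ->.
rewrite -(qmulE _ _ ur rbh) (qmulE _ _ ur' r'bh).
under eq_bigr => n _ do rewrite (qmulE _ _ us sb) mulr_sumr mulr_suml.
under [RHS]eq_bigr => k _ do rewrite (qmulE _ _ ut th) mulr_sumr.
rewrite [RHS]exchange_big /= big_seq [RHS]big_seq; apply: eq_bigr => n nt.
rewrite [RHS](@sum_supp_shift _ _ s _ n) //; last 2 first.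
- move=> k; rewrite mem_undup mem_cat negb_or => /andP[_ kst].
  rewrite sb ?mulr0 ?mul0r ?mulr0 //; apply: contraNN kst => kn.
  by rewrite -(subrK n k); apply/allpairsP; exists (k - n, n).
- by move=> k ks; rewrite addrK sb // mulr0 mul0r mulr0.
apply: eq_bigr => m _; rewrite addrK.
have -> : l - (m + n) = l - n - m by rewrite opprD addrA addrAC.
rewrite (_ : c (l - n) n = c (l - n - m) n * c m n); last by rewrite -cocycleDl subrK.
by rewrite cocycleDr; ring.
Qed.

Lemma qmulU0 a : qmul a (U 0) = a.
Proof.
apply/funext => k; rewrite (@qmulE [:: 0]) //; last first.
  by move=> m; rewrite inE /U => /negbTE ->.
by rewrite big_seq1 subr0 cocycle0r mul1r /U eqxx mulr1.
Qed.

(** The real part of tau (g^* h), meaningful as soon as one of the two is a polynomial. *)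
Definition dot g h : R := \sum_(n \in [set: zd]) rdot (g n) (h n).

Lemma dotE s g h : uniq s -> supp_in s h -> dot g h = \sum_(n <- s) rdot (g n) (h n).
Proof.
by move=> us sh; apply: fsum_supp => // m /sh ->; rewrite rdotE /= !mulr0 addr0.
Qed.

Lemma dotC g h : dot g h = dot h g.
Proof. by apply: eq_fsbigr => m _; exact: rdotC. Qed.

Lemma dot0r g : dot g 0 = 0.
Proof. by rewrite (@dotE [::]) // big_nil. Qed.

Lemma dotZDr (x : R) a g h : polynomial g -> polynomial h ->
  dot a (x%:C *: g + h) = x * dot a g + dot a h.
Proof.
move=> pg ph; have [s [us sg sh]] := polynomial2P pg ph.
rewrite (dotE _ us sg) (dotE _ us sh) (@dotE s) //; last first.
  by move=> m ms; rewrite serD serZ sg // sh // mulr0 addr0.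
rewrite mulr_sumr -big_split /=; apply: eq_bigr => n _.
by rewrite serD serZ rdotDr rdotZr.
Qed.

Lemma dotZDl (x : R) a g h : polynomial g -> polynomial h ->
  dot (x%:C *: g + h) a = x * dot g a + dot h a.
Proof. by move=> pg ph; rewrite ![dot _ a]dotC dotZDr. Qed.

Definition sqnorm h := dot h h.

Lemma sqnormE s h : uniq s -> supp_in s h -> sqnorm h = \sum_(n <- s) Normc.normc (h n) ^+ 2.
Proof.
by move=> us sh; rewrite /sqnorm (dotE _ us sh); apply: eq_bigr => n _; rewrite rdot_normc.
Qed.

Lemma sqnorm_ge0 h : 0 <= sqnorm h.
Proof. by apply: fsumr_ge0 => n _; exact: rdot_ge0. Qed.

Lemma sqnorm0 : sqnorm 0 = 0.
Proof. by rewrite (@sqnormE [::]) // big_nil. Qed.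

Lemma sqnormU m : sqnorm (U m) = 1.
Proof.
rewrite (@sqnormE [:: m]) //; last by move=> n; rewrite inE /U => /negbTE ->.
by rewrite big_seq1 /U eqxx Normc.normc1 expr1n.
Qed.

Lemma sqnormZ (x : R[i]) h : polynomial h -> sqnorm (x *: h) = Normc.normc x ^+ 2 * sqnorm h.
Proof.
move=> /polynomialP[s us sh]; rewrite (sqnormE us sh) (@sqnormE s) //; last first.
  by move=> m /sh hm; rewrite serZ hm mulr0.
rewrite mulr_sumr; apply: eq_bigr => n _.
by rewrite serZ Normc.normcM exprMn.
Qed.

Lemma sqnormZD (x : R) g h : polynomial g -> polynomial h ->
  sqnorm (x%:C *: g + h) = x ^+ 2 * sqnorm g + 2 * x * dot g h + sqnorm h.
Proof.
move=> pg ph; rewrite /sqnorm dotZDr // dotZDl // dotZDl // (dotC h g); ring.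
Qed.

(** The phase built into [star] is the right one because c(k - n, n - k) = c(k - n, n) times the
    conjugate of c(k - n, k). *)
Lemma dot_star a g h : polynomial g -> polynomial h ->
  dot (qmul a g) h = dot g (qmul (star theta a) h).
Proof.
move=> /polynomialP[s us sg] /polynomialP[t ut th].
rewrite (dotE _ ut th) dotC (dotE _ us sg).
under eq_bigr => k _ do rewrite rdotC (qmulE _ _ us sg) rdot_sumr.
rewrite exchange_big /=; apply: eq_bigr => n _.
rewrite rdotC (qmulE _ _ ut th) rdot_sumr; apply: eq_bigr => k _.
rewrite rdotC rdot_conj.
congr (rdot _ _); congr (_ * _).
rewrite /star opprB -(opprB k n) cocycleNl !rmorphM /=.
rewrite (_ : c (k - n) (- (k - n)) = c (k - n) n * (c (k - n) k)^*); last first.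
  by rewrite opprB cocycleDr cocycleNr.
by rewrite rmorphM /= conjCK [RHS]mulrA (mulrCA (_^*)) cocycle_conjM mulr1.
Qed.

End TwistedAlgebra.

(** * Operator norm *)

Section OperatorNorm.
Context {R : realType} {d : nat} (theta : 'M[R]_d).
Local Notation ser := (qseries R d).
Local Notation zd := 'rV[int]_d.
Implicit Types (a b g h : ser) (m n k : zd) (s t : seq zd).
Local Notation qmul := (qmul theta).
Local Notation opnorm := (opnorm theta).
Local Notation polynomial := Defs.polynomial.

Lemma fsbig_uniq_seq (T : Type) (idx : T) (op : Monoid.com_law idx) s (F : zd -> T) :
  uniq s -> \big[op/idx]_(m \in [set` s]) F m = \big[op/idx]_(m <- s) F m.
Proof.
move=> us; rewrite (@fsbigE _ _ _ _ _ s) //; last by move=> m /= ->.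
by apply: big_rmcond_in => m ms; rewrite mem_set.
Qed.

Lemma sum_supp_le s t (F : zd -> R) : uniq s -> uniq t ->
  (forall m, 0 <= F m) -> (forall m, m \notin s -> F m = 0) ->
  \sum_(m <- t) F m <= \sum_(m <- s) F m.
Proof.
move=> us ut F0 sF.
rewrite -(big_rmcond_in (r := t) (mem s)); last by move=> m _; exact: sF.
rewrite -big_filter (perm_big [seq m <- s | m \in t]); last first.
  by apply: uniq_perm; rewrite ?filter_uniq // => m; rewrite !mem_filter andbC.
by rewrite big_filter [leLHS]big_mkcond; apply: ler_sum => m _; case: ifP.
Qed.

(** The sum of squares is a supremum of finite sums. In this form a bound applies to series that are
    not polynomials and passes to coefficientwise limits. *)
Lemma l2norm_leP h (K : R) : 0 <= K ->
  (l2norm h <= K%:E)%E <->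
  forall s, uniq s -> \sum_(m <- s) Normc.normc (h m) ^+ 2 <= K ^+ 2.
Proof.
move=> K0; rewrite /l2norm.
have E0 : (0 <= \esum_(m in [set: zd]) (Normc.normc (h m) ^+ 2)%:E)%E.
  by apply: esum_ge0 => m _; rewrite lee_fin sqr_ge0.
have -> : (((\esum_(m in [set: zd]) (Normc.normc (h m) ^+ 2)%:E) `^ 2^-1)%E <= K%:E)%E =
  (\esum_(m in [set: zd]) (Normc.normc (h m) ^+ 2)%:E <= (K ^+ 2)%:E)%E.
  case: (\esum_(m in _) _) E0 => [r| |] //= r0; last by rewrite invr_eq0 pnatr_eq0.
  rewrite !lee_fin powR12_sqrt // -{2}(sqr_sqrtr r0).
  by rewrite ler_pXn2r ?nnegrE ?sqrtr_ge0.
split=> [H s us|H].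
  rewrite -lee_fin; apply: le_trans H; rewrite -sumEFin.
  apply: esum_ge; exists [set` s]; first by split => //; exact: finite_seq.
  by rewrite fsbig_uniq_seq.
apply: ge_ereal_sup => _ [F [finF _] <-].
case/finite_seqP: finF => s ->.
have -> : [set` s] = [set` undup s].
  by apply/seteqP; split => m /=; rewrite mem_undup.
rewrite fsbig_uniq_seq ?undup_uniq // sumEFin lee_fin.
exact/H/undup_uniq.
Qed.

Lemma polynomial_l2norm_leP h (K : R) : 0 <= K -> polynomial h ->
  (l2norm h <= K%:E)%E <-> sqnorm h <= K ^+ 2.
Proof.
move=> K0 /polynomialP[s us sh]; rewrite l2norm_leP //; split=> [H|H t ut].
  by rewrite (sqnormE us sh); exact: H.
apply: le_trans H; rewrite (sqnormE us sh); apply: sum_supp_le => // m.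
  exact: sqr_ge0.
by move=> /sh ->; rewrite Normc.normc0 expr0n.
Qed.

Lemma opnorm_leP a (K : R) :
  (opnorm a <= K%:E)%E <->
  forall h, polynomial h -> sqnorm h <= 1 -> (l2norm (qmul a h) <= K%:E)%E.
Proof.
split=> [H h ph h1|H].
  apply: le_trans H; apply: ereal_sup_ubound; exists h => //; split=> //.
  by apply: (polynomial_l2norm_leP ler01 ph).2; rewrite expr1n.
apply: ge_ereal_sup => _ [h [ph h1] <-]; apply: H => //.
by have := (polynomial_l2norm_leP ler01 ph).1 h1; rewrite expr1n.
Qed.

Lemma opnorm_ge0 a : (0 <= opnorm a)%E.
Proof.
apply: le_trans (ereal_sup_ubound _); last first.
  exists 0 => //; split; first exact: polynomial0.
  by apply: (polynomial_l2norm_leP ler01 polynomial0).2; rewrite sqnorm0 expr1n.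
exact: poweR_ge0.
Qed.

(** The unit vector [U 0] is mapped to a itself, one coefficient of which is at most its l^2
    norm. *)
Lemma normc_le_opnorm a m : ((Normc.normc (a m))%:E <= opnorm a)%E.
Proof.
have := opnorm_ge0 a; case E : (opnorm a) => [K| |] //; rewrite ?leey //.
rewrite !lee_fin => K0.
have /opnorm_leP/(_ _ (polynomialU 0)) : (opnorm a <= K%:E)%E by rewrite E.
rewrite qmulU0 sqnormU lexx => /(_ isT)/(l2norm_leP _ K0)/(_ [:: m] isT).
rewrite big_seq1 ler_pXn2r // nnegrE //.
by case: (a m) => x y /=; rewrite sqrtr_ge0.
Qed.

Lemma qmulZr (x : R[i]) a h : polynomial h -> qmul a (x *: h) = x *: qmul a h.
Proof.
move=> ph; have p0 := polynomial0 (R := R) (d := d).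
have q0 : qmul a 0 = 0.
  by apply/funext => k; rewrite (@qmulE _ _ _ [::]) // big_nil.
by rewrite -[x *: h]addr0 qmulZDr // q0 addr0.
Qed.

Lemma polynomial_opnorm_leP a (K : R) : 0 <= K -> polynomial a ->
  (opnorm a <= K%:E)%E <->
  forall h, polynomial h -> sqnorm (qmul a h) <= K ^+ 2 * sqnorm h.
Proof.
move=> K0 pa; rewrite opnorm_leP; split=> H h ph; last first.
  move=> h1; apply/polynomial_l2norm_leP => //; first exact: polynomial_qmul.
  by apply: (le_trans (H h ph)); rewrite ler_piMr // sqr_ge0.
have h0 := sqnorm_ge0 h; apply/ler_addgt0Pl => e e0.
(* h is normalized by the square root of w, which slightly exceeds |h|^2 so as to be positive even
   for h = 0. *)
pose w := sqnorm h + e / (K ^+ 2 + 1).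
have K1 : 0 < K ^+ 2 + 1 by rewrite ltr_wpDl // sqr_ge0.
have w0 : 0 < w by rewrite ltr_wpDl // divr_gt0.
pose y := (Num.sqrt w)^-1; have y2 : y ^+ 2 * w = 1.
  by rewrite /y exprVn sqr_sqrtr ?(ltW w0) // mulVf // gt_eqF.
have y20 : 0 < y ^+ 2 by rewrite exprn_gt0 // invr_gt0 sqrtr_gt0.
have sqnormY g : polynomial g -> sqnorm (y%:C *: g) = y ^+ 2 * sqnorm g.
  by move=> pg; rewrite sqnormZ //= expr0n addr0 sqr_sqrtr // sqr_ge0.
have py : polynomial (y%:C *: h) by exact: polynomialZ.
have hy : sqnorm (y%:C *: h) <= 1.
  by rewrite sqnormY // -y2 ler_pM2l // lerDl divr_ge0 // ltW.
have := (polynomial_l2norm_leP K0 (polynomial_qmul theta pa py)).1 (H _ py hy).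
rewrite qmulZr // sqnormY; last exact: polynomial_qmul.
move=> Hy; have {}Hy : sqnorm (qmul a h) <= K ^+ 2 * w.
  by rewrite -(ler_pM2l y20) mulrCA y2 mulr1.
apply: (le_trans Hy); rewrite /w mulrDr addrC lerD2r mulrCA.
by rewrite ler_piMr ?(ltW e0) // ler_pdivrMr // mul1r lerDl.
Qed.

(** The Cauchy-Schwarz inequality for a sum of [size r] vectors, by induction. *)
Lemma sqnorm_sum (r : seq zd) (v : zd -> ser) : (forall m, polynomial (v m)) ->
  sqnorm (\sum_(m <- r) v m) <= (size r)%:R * \sum_(m <- r) sqnorm (v m).
Proof.
move=> pv; elim: r => [|m r IH]; first by rewrite !big_nil sqnorm0 mul0r.
rewrite !big_cons; set u := \sum_(_ <- _) _ in IH *.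
set S := \sum_(_ <- _) sqnorm _ in IH *.
have pu : polynomial u by exact: polynomial_sum.
have := sqnormZD 1 (pv m) pu; rewrite scale1r => ->.
case: r @u @S IH pu => [|m' r] u S IH pu.
  have d0 : dot (v m) 0 = 0 by exact: dot0r.
  by rewrite /u /S !big_nil sqnorm0 d0 /=; lra.
set N : R := (size (m' :: r))%:R in IH *.
have N1 : 1 <= N by rewrite ler1n.
(* Expanding |u - N v|^2 >= 0 bounds the cross term: 2 <v, u> <= N |v|^2 + |u|^2 / N. *)
have := sqnorm_ge0 ((- N)%:C *: v m + u); rewrite sqnormZD //.
rewrite [(size _)%:R](_ : _ = N + 1); last by rewrite natr1.
have := sqnorm_ge0 (v m).
nra.
Qed.

Lemma qmulUE m h k : polynomial h ->
  qmul (U m) h k = cocycle theta m (k - m) * h (k - m).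
Proof.
move=> /polynomialP[s us sh].
have [r [ur kr rh]] : exists r, [/\ uniq r, k - m \in r & supp_in r h].
  exists (undup (k - m :: s)); split; first exact: undup_uniq.
    by rewrite mem_undup inE eqxx.
  by apply: supp_in_sub sh => n ns; rewrite mem_undup inE ns orbT.
rewrite (qmulE _ _ _ ur rh) (bigD1_seq (k - m)) //=.
rewrite big1 ?addr0 => [|n nk]; rewrite /U; last first.
  rewrite (_ : (k - n == m) = false) ?mulr0 ?mul0r //; apply/negbTE.
  by apply: contraNN nk => /eqP <-; rewrite opprB addrC subrK.
by rewrite opprB addrC subrK eqxx mulr1.
Qed.

Lemma sqnorm_qmulU m h : polynomial h -> sqnorm (qmul (U m) h) = sqnorm h.
Proof.
move=> ph; have := polynomial_qmul theta (polynomialU m) ph.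
move=> /polynomialP[t ut tUh]; have [s us sh] := (polynomialP _).1 ph.
rewrite (sqnormE ut tUh) (sqnormE us sh) (@sum_supp_shift _ _ t s _ m) //.
- apply: eq_bigr => n _; rewrite qmulUE // addrK Normc.normcM exprMn.
  by rewrite /cocycle -!rdot_normc !rdotE /= -!expr2 cos2Dsin2 mul1r.
- by move=> n /tUh ->; rewrite Normc.normc0 expr0n.
- by move=> n ns; rewrite qmulUE // addrK sh // mulr0 Normc.normc0 expr0n.
Qed.

Lemma supp_in_sum s a : uniq s -> supp_in s a -> a = \sum_(m <- s) a m *: U m.
Proof.
move=> us sa; apply/funext => k.
have -> : (\sum_(m <- s) a m *: (U m : ser)) k = \sum_(m <- s) a m * U m k.
  by elim/big_rec2: _ => [|m x y _ <-] //; rewrite serD serZ.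
have [ks|ks] := boolP (k \in s).
  rewrite (bigD1_seq k) //= /U eqxx mulr1 big1 ?addr0 // => m mk.
  by rewrite eq_sym (negbTE mk) mulr0.
rewrite sa // big_seq big1 // => m ms; rewrite /U.
by rewrite (_ : (k == m) = false) ?mulr0 //; apply: contraNF ks => /eqP ->.
Qed.

Lemma qmul_suml (s : seq zd) (F : zd -> ser) h : polynomial h ->
  qmul (\sum_(m <- s) F m) h = \sum_(m <- s) qmul (F m) h.
Proof.
move=> ph; elim: s => [|m s IH]; last first.
  rewrite !big_cons -IH; have := qmulZDl theta 1 (F m) (\sum_(m <- s) F m) ph.
  by rewrite !scale1r.
rewrite !big_nil; have [s us sh] := (polynomialP _).1 ph.
by apply/funext => k; rewrite (qmulE _ _ _ us sh) big1 // => n _; rewrite mulr0 mul0r.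
Qed.

(** Each term a(m) U^m h has norm |a(m)| |h| since U^m is an isometry; Cauchy-Schwarz over the
    frequencies then costs their number. This is the source of the factor N in the Nikolskii
    inequality. *)
Lemma sqnorm_qmul_le s a h : uniq s -> supp_in s a -> polynomial h ->
  sqnorm (qmul a h) <= (size s)%:R * sqnorm a * sqnorm h.
Proof.
move=> us sa ph; rewrite {1}(supp_in_sum us sa) qmul_suml //.
apply: (le_trans (sqnorm_sum _ _)) => [m|].
  by apply: polynomial_qmul => //; apply/polynomialZ/polynomialU.
rewrite -mulrA ler_wpM2l // (sqnormE us sa) mulr_suml; apply: ler_sum => m _.
have -> : qmul (a m *: U m) h = a m *: qmul (U m) h.
  have [s' us' sh'] := (polynomialP _).1 ph.
  apply/funext => k; rewrite serZ !(qmulE _ _ _ us' sh') mulr_sumr.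
  by apply: eq_bigr => n _; rewrite serZ; ring.
by rewrite sqnormZ ?sqnorm_qmulU //; apply: polynomial_qmul => //; exact: polynomialU.
Qed.

Lemma polynomial_opnorm_fin a : polynomial a ->
  exists2 M : R, 0 <= M & opnorm a = M%:E.
Proof.
move=> pa; have [s us sa] := (polynomialP _).1 pa.
have K0 : 0 <= (size s)%:R * sqnorm a by rewrite mulr_ge0 // sqnorm_ge0.
have := opnorm_ge0 a; have : (opnorm a <= (Num.sqrt ((size s)%:R * sqnorm a))%:E)%E.
  apply/polynomial_opnorm_leP; rewrite ?sqrtr_ge0 // => h ph.
  by rewrite sqr_sqrtr //; exact: sqnorm_qmul_le.
by case: (opnorm a) => [M| |] // _ M0; exists M.
Qed.

End OperatorNorm.

(** * Polynomial calculus of a positive element *)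

Section PolynomialCalculus.
Context {R : realType} {d : nat} (theta : 'M[R]_d).
Local Notation ser := (qseries R d).
Local Notation zd := 'rV[int]_d.
Local Notation qmul := (qmul theta).
Local Notation opnorm := (opnorm theta).
Local Notation polynomial := Defs.polynomial.
Implicit Types (a b g h : ser) (P Q : {poly R}).

(** The vector P(a) h; for h = [U 0] it is [qhorner theta P a] by conversion. *)
Definition act a P h : ser := \sum_(i < size P) (P`_i)%:C *: iter i (qmul a) h.

Lemma qhorner_act a P : qhorner theta P a = act a P (U 0).
Proof. by []. Qed.

Lemma actE a n P h : (size P <= n)%N ->
  act a P h = \sum_(i < n) (P`_i)%:C *: iter i (qmul a) h.
Proof.
move=> sPn; rewrite /act (big_ord_widen n (fun i => (P`_i)%:C *: iter i (qmul a) h)) //.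
rewrite big_mkcond /=; apply: eq_bigr => i _; case: ltnP => // Pi.
by rewrite nth_default // scale0r.
Qed.

Lemma act_ZD a (x : R) P Q h : act a (x *: P + Q) h = x%:C *: act a P h + act a Q h.
Proof.
pose n := maxn (size (x *: P + Q)) (maxn (size P) (size Q)).
rewrite !(@actE a n) ?leq_max ?leqnn ?orbT // scaler_sumr -big_split /=.
apply: eq_bigr => i _.
by rewrite coefD coefZ rmorphD rmorphM /= scalerDl scalerA.
Qed.

Lemma actC a (x : R) h : act a x%:P h = x%:C *: h.
Proof. by rewrite (@actE _ 1) ?size_polyC_leq1 // big_ord1 coefC. Qed.

Lemma act0 a h : act a 0 h = 0.
Proof. by rewrite -[0]/(0%:P) actC scale0r. Qed.

Lemma act1 a h : act a 1 h = h.
Proof. by rewrite -[1]/(1%:P) actC scale1r. Qed.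

Variables (a : ser) (pa : polynomial a).

Lemma polynomial_iter i h : polynomial h -> polynomial (iter i (qmul a) h).
Proof. by move=> ph; elim: i => //= i; exact: polynomial_qmul. Qed.

Lemma polynomial_act P h : polynomial h -> polynomial (act a P h).
Proof. by move=> ph; apply: polynomial_sum => i; apply/polynomialZ/polynomial_iter. Qed.

Lemma act_X P h : polynomial h -> act a ('X * P) h = qmul a (act a P h).
Proof.
move=> ph; have szX : (size ('X * P)%R <= (size P).+1)%N.
  by rewrite (leq_trans (size_polyMleq _ _)) // size_polyX.
rewrite (actE _ _ szX) big_ord_recl coefXM /= scale0r add0r /act.
have H n : qmul a (\sum_(i < n) (P`_i)%:C *: iter i (qmul a) h) =
    \sum_(i < n) (P`_i)%:C *: iter i.+1 (qmul a) h.
  elim: n => [|n IH]; rewrite ?big_ord0.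
    by apply/funext => k; rewrite (@qmulE _ _ _ [::]) // big_nil.
  rewrite !big_ord_recr /= addrC qmulZDr ?IH 1?addrC //.
    exact: polynomial_iter.
  by apply: polynomial_sum => i; apply/polynomialZ/polynomial_iter.
by rewrite H; apply: eq_bigr => i _; rewrite coefXM.
Qed.

Lemma act_XC P (x : R) h : polynomial h ->
  act a (P * 'X + x%:P) h = qmul a (act a P h) + x%:C *: h.
Proof.
move=> ph; have -> : P * 'X + x%:P = 1 *: ('X * P) + x%:P by rewrite scale1r mulrC.
by rewrite act_ZD actC act_X // scale1r.
Qed.

Lemma act_M P Q h : polynomial h -> act a (P * Q) h = act a P (act a Q h).
Proof.
move=> ph; elim/poly_ind: P => [|P x IH]; first by rewrite mul0r !act0.
have -> : (P * 'X + x%:P) * Q = 1 *: ('X * (P * Q)) + (x *: Q + 0).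
  by rewrite scale1r addr0 -mul_polyC; ring.
rewrite act_XC; last exact: polynomial_act.
by rewrite !act_ZD act0 addr0 act_X ?IH // scale1r.
Qed.

Lemma qmul_act P g h : polynomial g -> polynomial h ->
  qmul (act a P g) h = act a P (qmul g h).
Proof.
move=> pg ph; elim/poly_ind: P => [|P x IH].
  rewrite !act0; apply/funext => k; have [s us sh] := (polynomialP h).1 ph.
  by rewrite (qmulE _ _ _ us sh) big1 // => n _; rewrite mulr0 mul0r.
have pP := polynomial_act P pg.
rewrite !act_XC //; last exact: polynomial_qmul.
by rewrite addrC qmulZDl // qmulA // IH addrC.
Qed.

Lemma qmul0U h : polynomial h -> qmul (U 0) h = h.
Proof.
by move=> ph; apply/funext => k; rewrite qmulUE // subr0 cocycle0l mul1r.
Qed.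

Lemma qmul_qhorner P h : polynomial h -> qmul (qhorner theta P a) h = act a P h.
Proof.
by move=> ph; rewrite qhorner_act qmul_act ?qmul0U //; exact: polynomialU.
Qed.

Lemma qhornerB P Q : qhorner theta P a - qhorner theta Q a = qhorner theta (P - Q) a.
Proof.
rewrite !qhorner_act; have -> : P - Q = (- 1) *: Q + P by rewrite scaleN1r addrC.
by rewrite act_ZD rmorphN1 scaleN1r addrC.
Qed.

End PolynomialCalculus.

(** * Positivity and norm bounds for polynomials in a positive element *)

Section PositiveElement.
Context {R : realType} {d : nat} (theta : 'M[R]_d).
Local Notation ser := (qseries R d).
Local Notation qmul := (qmul theta).
Local Notation opnorm := (opnorm theta).
Local Notation polynomial := Defs.polynomial.
Local Notation qhorner := (qhorner theta).
Implicit Types (g h : ser) (P Q : {poly R}).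

(** Cauchy-Schwarz, from |g - K h|^2 >= 0 divided by K; K is replaced by K + e' to have a positive
    divisor. *)
Lemma dot_le (K : R) g h : 0 <= K -> polynomial g -> polynomial h ->
  sqnorm g <= K ^+ 2 * sqnorm h -> dot h g <= K * sqnorm h.
Proof.
move=> K0 pg ph gh; have h0 := sqnorm_ge0 h.
apply/ler_addgt0Pl => e e0; pose e' := e / (sqnorm h + 1).
have h1 : 0 < sqnorm h + 1 by rewrite ltr_wpDl.
have e'0 : 0 < e' by rewrite divr_gt0.
have e'h : e' * sqnorm h <= e.
  by rewrite /e' mulrAC ler_pdivrMr // ler_pM2l // lerDl.
have Ke : 0 < K + e' by rewrite ltr_wpDl.
have := sqnorm_ge0 ((- (K + e'))%:C *: h + g); rewrite sqnormZD // => H.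
have H2 : (K + e') * dot h g <= (K + e') * ((K + e') * sqnorm h).
  have : K ^+ 2 * sqnorm h <= (K + e') ^+ 2 * sqnorm h by rewrite ler_wpM2r //; nra.
  nra.
by rewrite ler_pM2l // in H2; lra.
Qed.

Variables (c : ser) (pc : polynomial c).
Let a := qmul (star theta c) c.

Lemma polynomial_starmul : polynomial a.
Proof. by apply: polynomial_qmul => //; exact: polynomial_star. Qed.
Let pa := polynomial_starmul.

Lemma dot_starmul g h : polynomial g -> polynomial h ->
  dot g (qmul a h) = dot (qmul c g) (qmul c h).
Proof.
move=> pg ph; rewrite qmulA // dot_star //; exact: polynomial_qmul.
Qed.

Lemma dot_iter i g h : polynomial g -> polynomial h ->
  dot g (iter i (qmul a) h) = dot (iter i (qmul a) g) h.
Proof.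
move=> pg; elim: i h => // i IH h ph; rewrite iterSr IH; last exact: polynomial_qmul.
have pig := polynomial_iter theta pa i pg.
by rewrite dot_starmul // dotC -dot_starmul // dotC.
Qed.

Lemma dot_act P g h : polynomial g -> polynomial h ->
  dot g (act theta a P h) = dot (act theta a P g) h.
Proof.
move=> pg ph; rewrite /act; elim: (size P) => [|n IH].
  by rewrite !big_ord0 (dotC 0) !dot0r.
have psum (f : ser) : polynomial f ->
    polynomial (\sum_(i < n) (P`_i)%:C *: iter i (qmul a) f).
  by move=> pf; apply: polynomial_sum => i; apply/polynomialZ/polynomial_iter.
rewrite !big_ord_recr /= ![\sum_(i < n) _ + _]addrC.
by rewrite dotZDr ?dotZDl ?IH ?dot_iter //; try exact: psum; exact: polynomial_iter.
Qed.

Variables (M : R) (M0 : 0 <= M) (aM : opnorm a = M%:E).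

(** Here |c h|^2 = <h, a h>, which is at most M |h|^2 by Cauchy-Schwarz. *)
Lemma sqnorm_qmul_starmul h : polynomial h -> sqnorm (qmul c h) <= M * sqnorm h.
Proof.
move=> ph; rewrite /sqnorm -dot_starmul //; apply: dot_le => //.
  exact: polynomial_qmul.
by apply: (polynomial_opnorm_leP theta M0 pa).1 => //; rewrite aM.
Qed.

Lemma opnorm_le_sqrt : (opnorm c <= (Num.sqrt M)%:E)%E.
Proof.
apply/polynomial_opnorm_leP; rewrite ?sqrtr_ge0 // => h ph.
by rewrite sqr_sqrtr //; exact: sqnorm_qmul_starmul.
Qed.

(** The functional L Q = <h, Q(a) h> satisfies the hypotheses of [pos_functional_poly]: with g =
    Q(a) h, its values at Q^2, X Q^2 and (M - X) Q^2 are |g|^2, |c g|^2 and M |g|^2 - |c g|^2. *)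
Lemma act_ge0 P h : polynomial h -> (forall t, 0 <= t <= M -> 0 <= P.[t]) ->
  0 <= dot h (act theta a P h).
Proof.
move=> ph; pose L Q := dot h (act theta a Q h).
have pact Q : polynomial (act theta a Q h) by exact: polynomial_act.
have LM Q1 Q2 : L (Q1 * (Q1 * Q2)) =
    dot (act theta a Q1 h) (act theta a Q2 (act theta a Q1 h)).
  rewrite /L act_M // dot_act //.
  by rewrite mulrC act_M.
have linL : scalar L.
  by move=> x Q1 Q2; rewrite /L act_ZD dotZDr.
move=> P0; apply: (pos_functional_poly M0 linL) P0 => Q.
- by rewrite expr2 -[Q * Q]mulr1 -mulrA LM act1; exact: sqnorm_ge0.
- rewrite (_ : 'X * Q ^+ 2 = Q * (Q * ('X * 1))); last by ring.
  rewrite LM act_X // act1 dot_starmul //; exact: sqnorm_ge0.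
- rewrite (_ : (M%:P - 'X) * Q ^+ 2 = Q * (Q * ((- 1) *: ('X * 1) + M%:P))); last first.
    by rewrite scaleN1r; ring.
  rewrite LM; set g := act theta a Q h.
  have pg : polynomial g by exact: pact.
  rewrite act_ZD act_X // actC act1.
  have pag : polynomial (qmul a g) by exact: polynomial_qmul.
  rewrite dotZDr //; last exact: polynomialZ.
  rewrite -[M%:C *: g]addr0 dotZDr //; last exact: polynomial0.
  rewrite dot0r addr0 dot_starmul //.
  have := sqnorm_qmul_starmul pg; rewrite /sqnorm; lra.
Qed.

(** Positivity applied to the polynomial e^2 - P^2. *)
Lemma sqnorm_act_le P h (e : R) : polynomial h ->
  (forall t, 0 <= t <= M -> `|P.[t]| <= e) ->
  sqnorm (act theta a P h) <= e ^+ 2 * sqnorm h.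
Proof.
move=> ph Pe; have pact Q : polynomial (act theta a Q h) by exact: polynomial_act.
have := @act_ge0 ((- 1) *: (P * P) + (e ^+ 2)%:P) h ph.
rewrite act_ZD actC dotZDr //; last exact: polynomialZ.
rewrite act_M // dot_act // -/(sqnorm _) -[(e ^+ 2)%:C *: h]addr0 dotZDr //; last first.
  exact: polynomial0.
rewrite dot0r addr0 => H.
suff : 0 <= -1 * sqnorm (act theta a P h) + e ^+ 2 * dot h h by rewrite /sqnorm; lra.
apply: H => t /Pe; rewrite hornerD hornerZ hornerM hornerC => Pt.
have : `|P.[t]| ^+ 2 <= e ^+ 2 by rewrite lerXn2r ?nnegrE // (le_trans _ Pt).
rewrite real_normK ?num_real //; lra.
Qed.

Lemma opnorm_qhorner_le P (e : R) : 0 <= e ->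
  (forall t, 0 <= t <= M -> `|P.[t]| <= e) -> (opnorm (qhorner P a) <= e%:E)%E.
Proof.
move=> e0 Pe; apply/polynomial_opnorm_leP => //.
  by rewrite qhorner_act; apply/polynomial_act => //; exact: polynomialU.
by move=> h ph; rewrite qmul_qhorner //; exact: sqnorm_act_le.
Qed.

Lemma Re_tau_qhorner_ge0 P : (forall t, 0 <= t <= M -> 0 <= P.[t]) ->
  0 <= complex.Re (tau (qhorner P a)).
Proof.
move=> /act_ge0-/(_ _ (polynomialU 0)); rewrite qhorner_act dotC.
rewrite (@dotE _ _ [:: 0]) //; last by move=> m; rewrite inE /U => /negbTE ->.
by rewrite big_seq1 rdotE /U eqxx /= mulr1 mulr0 addr0.
Qed.
End PositiveElement.

(** * Continuous functional calculus *)

Section ComplexLimits.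
Context {R : realType}.
Implicit Types (u v : nat -> R[i]) (x y z w : R[i]).

Definition ccvg u z :=
  (complex.Re (u n) @[n --> \oo] --> complex.Re z) /\
  (complex.Im (u n) @[n --> \oo] --> complex.Im z).

Lemma ccvg_cst z : ccvg (fun=> z) z.
Proof. by split; exact: cvg_cst. Qed.

Lemma ccvgD u v x y : ccvg u x -> ccvg v y -> ccvg (fun n => u n + v n) (x + y).
Proof.
move=> [u1 u2] [v1 v2]; split.
  rewrite (_ : (fun n => _) = (fun n => complex.Re (u n) + complex.Re (v n))).
    by case: x y u1 u2 v1 v2 => [? ?] [? ?] /= u1 _ v1 _; exact: cvgD.
  by apply/funext => n; case: (u n) (v n) => ? ? [].
rewrite (_ : (fun n => _) = (fun n => complex.Im (u n) + complex.Im (v n))).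
  by case: x y u1 u2 v1 v2 => [? ?] [? ?] /= _ u2 _ v2; exact: cvgD.
by apply/funext => n; case: (u n) (v n) => ? ? [].
Qed.

Lemma ccvgM w u x : ccvg u x -> ccvg (fun n => w * u n) (w * x).
Proof.
move=> [u1 u2]; split.
  rewrite (_ : (fun n => _) = (fun n => complex.Re w * complex.Re (u n) -
      complex.Im w * complex.Im (u n))).
    case: w x u1 u2 => [? ?] [? ?] /= u1 u2.
    by apply: cvgB; apply: cvgM => //; exact: cvg_cst.
  by apply/funext => n; case: w (u n) => ? ? [].
rewrite (_ : (fun n => _) = (fun n => complex.Re w * complex.Im (u n) +
    complex.Im w * complex.Re (u n))).
  case: w x u1 u2 => [? ?] [? ?] /= u1 u2.
  by apply: cvgD; apply: cvgM => //; exact: cvg_cst.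
by apply/funext => n; case: w (u n) => ? ? [].
Qed.

Lemma ccvg_sum (I : Type) (r : seq I) (u : I -> nat -> R[i]) (x : I -> R[i]) :
  (forall i, ccvg (u i) (x i)) ->
  ccvg (fun n => \sum_(i <- r) u i n) (\sum_(i <- r) x i).
Proof.
move=> ux; elim: r => [|i r IH].
  rewrite big_nil (_ : (fun n => _) = fun=> 0); first exact: ccvg_cst.
  by apply/funext => n; rewrite big_nil.
rewrite big_cons (_ : (fun n => _) = fun n => u i n + \sum_(j <- r) u j n).
  exact: ccvgD.
by apply/funext => n; rewrite big_cons.
Qed.

Lemma ccvg_normc u x : ccvg u x ->
  Normc.normc (u n) ^+ 2 @[n --> \oo] --> Normc.normc x ^+ 2.
Proof.
move=> [u1 u2]; rewrite -rdot_normc rdotE.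
rewrite (_ : (fun n => _) = fun n => complex.Re (u n) * complex.Re (u n) +
   complex.Im (u n) * complex.Im (u n)).
  by apply: cvgD; apply: cvgM.
by apply/funext => n; rewrite -rdot_normc rdotE.
Qed.

Lemma cvg_harmonic_cauchy (u : nat -> R) :
  (forall n k, (n <= k)%N -> `|u n - u k| <= n.+1%:R^-1) -> cvgn u.
Proof.
move=> uC; apply: cauchy_cvg; apply: cauchy_exP => e e0.
pose n := Num.truncn e^-1; exists (u n).
exists n => // k /= nk; rewrite /ball /=; apply: (le_lt_trans (uC _ _ nk)).
by rewrite invf_plt ?posrE // truncnS_gt.
Qed.

Lemma ccvg_harmonic_cauchy u :
  (forall n k, (n <= k)%N -> Normc.normc (u n - u k) <= n.+1%:R^-1) ->
  exists z, ccvg u z.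
Proof.
move=> uC.
have Re_le x : `|complex.Re x| <= Normc.normc x.
  case: x => a b /=; rewrite -(sqrtr_sqr a) ler_wsqrtr // lerDl sqr_ge0 //.
have Im_le x : `|complex.Im x| <= Normc.normc x.
  case: x => a b /=; rewrite -(sqrtr_sqr b) ler_wsqrtr // lerDr sqr_ge0 //.
have c1 : cvgn (fun n => complex.Re (u n)).
  apply: cvg_harmonic_cauchy => n k nk; apply: le_trans (uC _ _ nk).
  by apply: le_trans (Re_le _); case: (u n) (u k) => ? ? [].
have c2 : cvgn (fun n => complex.Im (u n)).
  apply: cvg_harmonic_cauchy => n k nk; apply: le_trans (uC _ _ nk).
  by apply: le_trans (Im_le _); case: (u n) (u k) => ? ? [].
by exists (limn (fun n => complex.Re (u n)) +i* limn (fun n => complex.Im (u n))).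
Qed.
End ComplexLimits.

(** * Existence of f(a) and comparison of traces *)

Section FunctionalCalculus.
Context {R : realType} {d : nat} (theta : 'M[R]_d).
Local Notation ser := (qseries R d).
Local Notation qmul := (qmul theta).
Local Notation opnorm := (opnorm theta).
Local Notation polynomial := Defs.polynomial.
Local Notation qhorner := (qhorner theta).
Implicit Types (g h b : ser) (P Q : {poly R}) (f : R -> R).
Variables (c : ser) (pc : polynomial c).
Let a := qmul (star theta c) c.
Variables (M : R) (M0 : 0 <= M) (aM : opnorm a = M%:E).

Let a_range (t : R) : 0 <= t -> (t%:E <= opnorm a)%E -> 0 <= t <= M.
Proof. by rewrite aM lee_fin => -> ->. Qed.

(** The elements P_n(a) are Cauchy for the operator norm, which dominates each coefficient, so the
    coefficients converge. *)
Lemma fun_calc_exists f :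
  (forall e : R, 0 < e -> exists P, forall t, 0 <= t <= M -> `|P.[t] - f t| <= e) ->
  exists b, is_fun_calc theta f a b.
Proof.
move=> approx.
(* The factor 1/2 makes P_n and P_k differ by at most 1 / (n + 1) on [0, M] for n <= k. *)
have /choice[P PH] : forall n, exists P,
    forall t, 0 <= t <= M -> `|P.[t] - f t| <= 2^-1 * n.+1%:R^-1.
  by move=> n; apply: approx; rewrite mulr_gt0 // invr_gt0.
pose q n := qhorner (P n) a.
have qC n k : (n <= k)%N -> (opnorm (q n - q k)%R <= (n.+1%:R^-1)%:E)%E.
  move=> nk; rewrite qhornerB; apply: (opnorm_qhorner_le pc M0 aM);
    rewrite ?invr_ge0 // => t tM.
  rewrite hornerD hornerN; have -> : (P n).[t] - (P k).[t] =
    ((P n).[t] - f t) - ((P k).[t] - f t) by ring.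
  apply: (le_trans (ler_normB _ _)); apply: (le_trans (lerD (PH _ _ tM) (PH _ _ tM))).
  have : k.+1%:R^-1 <= n.+1%:R^-1 :> R by rewrite lef_pV2 ?posrE ?ler_nat.
  by set x := n.+1%:R^-1; set y := k.+1%:R^-1; lra.
have /choice[b bH] : forall m, exists z, ccvg (fun n => q n m) z.
  move=> m; apply: ccvg_harmonic_cauchy => n k nk; rewrite -lee_fin.
  apply: le_trans (qC _ _ nk); have := normc_le_opnorm theta (q n - q k) m.
  by [].
(* The bound on P_n(a) - P_k(a) passes to the coefficientwise limit b of
   P_k(a) on the finite sums of squares of coefficients. *)
exists b, P; split.
  move=> e e0; near=> n => t t0 tM; apply: le_trans (PH _ _ (a_range t0 tM)) _.
  apply: (@le_trans _ _ n.+1%:R^-1).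
    by rewrite ler_piMl ?invr_ge0 // invf_le1 // ler1n.
  by apply: ltW; near: n; exact: (near_infty_natSinv_lt (PosNum e0)).
have qb n : (opnorm (q n - b)%R <= (n.+1%:R^-1)%:E)%E.
  apply/opnorm_leP => h ph h1; apply/l2norm_leP; first by rewrite invr_ge0.
  move=> s us; have [r ur rh] := (polynomialP h).1 ph.
  have H k : (n <= k)%N ->
    \sum_(m <- s) Normc.normc (qmul (q n - q k) h m) ^+ 2 <= n.+1%:R^-1 ^+ 2.
    move=> nk; move: (qC _ _ nk) => /opnorm_leP/(_ _ ph h1)/l2norm_leP.
    by apply => //; rewrite invr_ge0.
  have cv : (fun k => \sum_(m <- s) Normc.normc (qmul (q n - q k) h m) ^+ 2) @ \oo -->
     \sum_(m <- s) Normc.normc (qmul (q n - b) h m) ^+ 2.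
    apply: cvg_big => [|m _]; first exact: add_continuous.
    apply: ccvg_normc.
    rewrite (qmulE _ _ _ ur rh).
    rewrite (_ : (fun k => _) = fun k => \sum_(j <- r)
      (cocycle theta (m - j) j * h j) * (q n (m - j) + (-1) * q k (m - j))); last first.
      apply/funext => k; rewrite (qmulE _ _ _ ur rh); apply: eq_bigr => j _.
      rewrite [(_ - _) _](_ : _ = q n (m - j) - q k (m - j)) //; ring.
    rewrite (_ : \sum_(j <- r) _ = \sum_(j <- r)
      (cocycle theta (m - j) j * h j) * (q n (m - j) + (-1) * b (m - j))); last first.
      apply: eq_bigr => j _.
      rewrite [(_ - _) _](_ : _ = q n (m - j) - b (m - j)) //; ring.
    apply: ccvg_sum => j; apply: ccvgM; apply: ccvgD; first exact: ccvg_cst.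
    exact: ccvgM.
  apply: (cvgr_to_le cv); near=> k; apply: H; near: k; exact: nbhs_infty_ge.
apply: (@squeeze_cvge _ _ _ _ (cst 0%E) _ (EFin \o harmonic)).
- by apply: nearW => n; rewrite opnorm_ge0 qb.
- exact: cvg_cst.
- exact: cvge_harmonic.
Unshelve. all: by end_near. Qed.

(** The coefficient at 0 is bounded by the operator norm, so tau passes to the limit. Nothing is
    asked of b beyond [is_fun_calc], the property by which [xget] chooses the value of
    [fun_calc]. *)
Lemma fun_calc_tau_approx f b (e : R) : is_fun_calc theta f a b -> 0 < e ->
  exists P, (forall t, 0 <= t <= M -> `|P.[t] - f t| <= e) /\
    `|complex.Re (tau b) - complex.Re (tau (qhorner P a))| <= e.
Proof.
move=> [P [PH Pb]] e0.
have /fine_cvgP[finP /cvgrPdist_le/(_ _ e0) Pe] := Pb.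
have HP := PH _ e0.
suff [n [n1 n2 n3]] : exists n, [/\ opnorm (qhorner (P n) a - b)%R \is a fin_num,
  `|0 - fine (opnorm (qhorner (P n) a - b))| <= e &
  forall t : R, 0 <= t -> (t%:E <= opnorm a)%E -> `|(P n).[t] - f t| <= e].
  exists (P n); split.
    by move=> t /andP[t0 tM]; apply: n3 => //; rewrite aM lee_fin.
  have := normc_le_opnorm theta (qhorner (P n) a - b) 0.
  rewrite -(fineK n1) lee_fin; move: n2; rewrite sub0r normrN => n2 H.
  rewrite distrC; apply: le_trans n2; apply: (le_trans _ (ler_norm _)).
  apply: le_trans H; rewrite /tau [(_ - b) 0](_ : _ = qhorner (P n) a 0 - b 0) //.
  case: (qhorner _ _ _) (b 0) => x1 x2 [y1 y2] /=.
  by rewrite -(sqrtr_sqr (x1 - y1)) ler_wsqrtr // lerDl sqr_ge0.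
near \oo => n; exists n; split; near: n => //.
Unshelve. all: by end_near. Qed.

Lemma fun_calc_tau_le (f1 f2 : R -> R) b1 b2 (K : R) : 0 <= K ->
  is_fun_calc theta f1 a b1 -> is_fun_calc theta f2 a b2 ->
  (forall t, 0 <= t <= M -> f1 t <= K * f2 t) ->
  complex.Re (tau b1) <= K * complex.Re (tau b2).
Proof.
move=> K0 H1 H2 f12; apply/ler_addgt0Pl => e e0.
have K2 : 0 < 2 + 2 * K by lra.
(* An error e' + K e' is spent on making K P2 - P1 + (e' + K e') nonnegative on [0, M], and as much
   again on passing from the traces of P1(a) and P2(a) to those of b1 and b2. *)
pose e' := e / (2 + 2 * K); have e'0 : 0 < e' by rewrite divr_gt0.
have e'E : e = 2 * e' + 2 * K * e'.
  by rewrite -mulrDl /e' mulrCA divff ?mulr1 // gt_eqF.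
have [P1 [P1f P1b]] := fun_calc_tau_approx H1 e'0.
have [P2 [P2f P2b]] := fun_calc_tau_approx H2 e'0.
have := Re_tau_qhorner_ge0 pc M0 aM (P :=
  (K *: P2 + ((- 1) *: P1 + (e' + K * e')%:P))).
rewrite qhorner_act !act_ZD actC -!qhorner_act /tau !serD !serZ.
have -> : complex.Re (K%:C * qhorner P2 a 0 + ((-1)%:C * qhorner P1 a 0 +
   (e' + K * e')%:C * (U 0 : ser) 0)) = K * complex.Re (qhorner P2 a 0) -
   complex.Re (qhorner P1 a 0) + (e' + K * e').
  rewrite (_ : (U 0 : ser) 0 = 1) ?mulr1; last by rewrite /U eqxx.
  by case: (qhorner P2 a 0) (qhorner P1 a 0) => ? ? [? ?] /=; ring.
have H t : 0 <= t <= M ->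
    0 <= (K *: P2 + ((- 1) *: P1 + (e' + K * e')%:P)).[t].
  move=> tM; rewrite !hornerD !hornerZ hornerC.
  have /ler_normlP[_ h1] := P1f _ tM; have /ler_normlP[h2 _] := P2f _ tM.
  have := f12 _ tM; nra.
move=> /(_ H); move: P1b P2b; rewrite /tau !ler_norml => /andP[_ u1] /andP[u2 _].
nra.
Qed.

Lemma is_fun_calc_horner P : is_fun_calc theta (horner P) a (qhorner P a).
Proof.
exists (fun=> P); split.
  by move=> e e0; apply: nearW => n t _ _; rewrite subrr normr0 ltW.
rewrite qhornerB subrr qhorner_act act0.
have -> : opnorm 0 = 0%E.
  apply/eqP; rewrite eq_le opnorm_ge0 andbT; apply/polynomial_opnorm_leP => //.
    exact: polynomial0.
  move=> h ph; rewrite expr0n mul0r (_ : qmul 0 h = 0) ?sqnorm0 //.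
  have [s us sh] := (polynomialP h).1 ph; apply/funext => k.
  by rewrite (qmulE _ _ _ us sh) big1 // => n _; rewrite mulr0 mul0r.
exact: cvg_cst.
Qed.

(** By Weierstrass approximation some value exists, so [xget] does not return its default 0. *)
Lemma is_fun_calc_abs_pow (r : R) : 1 <= r ->
  is_fun_calc theta (fun t => t `^ (r / 2)) a (abs_pow theta c r).
Proof.
move=> r1; apply: xgetPex; apply: fun_calc_exists => e e0.
exact: weierstrass_half_powR.
Qed.

(** Comparison of t^(r/2) with the polynomial 0. *)
Lemma tau_abs_pow_ge0 (r : R) : 1 <= r -> 0 <= complex.Re (tau (abs_pow theta c r)).
Proof.
move=> r1.
have := fun_calc_tau_le ler01 (is_fun_calc_horner 0) (is_fun_calc_abs_pow r1).
rewrite qhorner_act act0 mul1r; apply => t _.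
by rewrite horner0 mul1r powR_ge0.
Qed.

End FunctionalCalculus.

(** * The Nikolskii inequality *)

Lemma powR_split_le (R : realType) (t M u v : R) : 0 <= t <= M -> 0 <= u -> 0 < v ->
  t `^ (u + v) <= M `^ u * t `^ v.
Proof.
move=> /andP[t0 tM] u0 v0; rewrite powRD; last by apply/implyP; lra.
by rewrite ler_wpM2r ?powR_ge0 // ge0_ler_powR ?nnegrE // (le_trans t0).
Qed.

Section Nikolskii.
Context {R : realType} {d : nat} (theta : 'M[R]_d).
Local Notation ser := (qseries R d).
Local Notation qmul := (qmul theta).
Local Notation opnorm := (opnorm theta).
Local Notation polynomial := Defs.polynomial.
Local Notation qhorner := (qhorner theta).
Local Notation act := (act theta).
Implicit Types (g h b : ser) (P Q : {poly R}) (f : R -> R).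
Variables (c : ser) (pc : polynomial c).
Let a := qmul (star theta c) c.
Variables (M : R) (M0 : 0 <= M) (aM : opnorm a = M%:E).
Let pa : polynomial a := polynomial_starmul theta pc.

Lemma sqnorm_act_X k h : polynomial h -> sqnorm (act a 'X^k h) = dot h (act a 'X^(k + k) h).
Proof.
move=> ph; rewrite exprD act_M // dot_act //; exact: polynomial_act.
Qed.

(* If ||a^(2n)|| <= K, then |a^n h|^2 = <h, a^(2n) h> <= K |h|^2. *)
Lemma opnorm_starmul_pow_le j (K : R) : 0 <= K ->
  (forall h, polynomial h -> sqnorm (act a 'X^(2 ^ j) h) <= K ^+ 2 * sqnorm h) ->
  M ^+ (2 ^ j) <= K.
Proof.
elim: j K => [|j IH] K K0 HK.
  rewrite expn0 expr1 -lee_fin -aM; apply/polynomial_opnorm_leP => // h ph.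
  by have := HK h ph; rewrite expn0 expr1 -['X]mulr1 act_X // act1.
rewrite expnSr exprM -(sqr_sqrtr K0) ler_pXn2r ?nnegrE ?exprn_ge0 ?sqrtr_ge0 //.
apply: IH => [|h ph]; first exact: sqrtr_ge0.
rewrite sqr_sqrtr // sqnorm_act_X //; apply: dot_le => //; first exact: polynomial_act.
by have := HK h ph; rewrite expnS mul2n -addnn.
Qed.

(** Let b = a^(2^j), which is symmetric. Then |b h|^2 <= (size s) |b|^2 |h|^2 for every h, and |b|^2
    = tau (b^2); the square root of (size s) |b|^2 serves as K in [opnorm_starmul_pow_le]. *)
Lemma opnorm_starmul_le_tau s j : uniq s -> supp_in s (act a 'X^(2 ^ j) (U 0)) ->
  M ^+ (2 * 2 ^ j) <= (size s)%:R * complex.Re (tau (qhorner 'X^(2 * 2 ^ j) a)).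
Proof.
move=> us sa; set b := act a _ _ in sa.
have pU := polynomialU (R := R) (0 : 'rV[int]_d).
have -> : complex.Re (tau (qhorner 'X^(2 * 2 ^ j) a)) = sqnorm b.
  rewrite sqnorm_act_X // mul2n -addnn dotC (@dotE _ _ [:: 0]) //; last first.
    by move=> m; rewrite inE /U => /negbTE ->.
  by rewrite big_seq1 rdotE /U eqxx /= mulr1 mulr0 addr0.
have K0 : 0 <= (size s)%:R * sqnorm b by rewrite mulr_ge0 // sqnorm_ge0.
rewrite mulnC exprM -(sqr_sqrtr K0) ler_pXn2r ?nnegrE ?exprn_ge0 ?sqrtr_ge0 //.
apply: opnorm_starmul_pow_le; first exact: sqrtr_ge0.
move=> h ph; rewrite sqr_sqrtr // -(@qmul0U _ _ theta h) // -qmul_act // qmul0U //.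
exact: sqnorm_qmul_le.
Qed.

Section Exponent.
Variables (p : R) (p1 : 1 <= p).
Let T := complex.Re (tau (abs_pow theta c p)).
Let p0 : 0 < p. Proof. exact: lt_le_trans p1. Qed.
Let T0 : 0 <= T. Proof. exact: (tau_abs_pow_ge0 pc M0 aM p1). Qed.

Variables (s : seq 'rV[int]_d) (j : nat) (N : R).
Hypotheses (us : uniq s) (sa : supp_in s (act a 'X^(2 ^ j) (U 0))).
Hypotheses (sN : (size s)%:R <= N) (pj : p <= (4 * 2 ^ j)%:R).

Lemma opnorm_starmul_powR_le : M `^ (p / 2) <= N * T.
Proof.
have N0 : 0 <= N by apply: le_trans sN.
have [M00|Mn0] := eqVneq M 0.
  by rewrite M00 powR0 ?mulr_ge0 // gt_eqF // divr_gt0.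
have Mp : 0 < M by rewrite lt_def Mn0.
set n := (2 * 2 ^ j)%N; have n0 : (0 < n)%N by rewrite muln_gt0 expn_gt0.
(* u >= 0 because p <= 2 n. Then tau (a^n) <= M^u T, and M^u is cancelled from M^n = M^u M^(p/2),
   which is why M = 0 was set apart. *)
pose u : R := n%:R - p / 2.
have u0 : 0 <= u.
  by rewrite /u subr_ge0 ler_pdivrMr // -natrM mulnAC.
have H : complex.Re (tau (qhorner 'X^n a)) <= M `^ u * T.
  apply: (fun_calc_tau_le pc M0 aM (powR_ge0 _ _) (is_fun_calc_horner _ _ _)
    (is_fun_calc_abs_pow pc M0 aM p1)) => t tM.
  rewrite hornerXn -powR_mulrn; last by case/andP: tM.
  rewrite [n%:R](_ : _ = u + p / 2); last by rewrite /u subrK.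
  by apply: powR_split_le => //; rewrite divr_gt0.
have := opnorm_starmul_le_tau us sa; rewrite -/n => H2.
have {}H2 : M `^ u * M `^ (p / 2) <= M `^ u * (N * T).
  rewrite -powRD; last by rewrite Mn0 implybT.
  rewrite /u subrK powR_mulrn //; apply: (le_trans H2).
  apply: (le_trans (ler_wpM2l _ H)) => //; rewrite mulrCA.
  by rewrite ler_wpM2l ?powR_ge0 // ler_wpM2r.
by rewrite ler_pM2l ?powR_gt0 // in H2.
Qed.

Lemma tau_abs_pow_nikolskii (r : R) : p < r ->
  complex.Re (tau (abs_pow theta c r)) `^ r^-1 <=
  N `^ (p^-1 - r^-1) * T `^ p^-1.
Proof.
move=> pr; have r1 : 1 <= r by apply: le_trans p1 (ltW pr).
have r0 : 0 < r by exact: lt_le_trans r1.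
have N0 : 0 <= N by apply: le_trans sN.
set Tr := complex.Re _.
have Tr0 : 0 <= Tr by exact: (tau_abs_pow_ge0 pc M0 aM r1).
(* M^((r - p)/2) = (M^(p/2))^u <= (N T)^u, which yields N^u T^(u + 1) with u + 1 = r / p; the r-th
   root turns u into 1/p - 1/r. *)
pose u := (r - p) / p; have u0 : 0 <= u by rewrite divr_ge0 ?subr_ge0 // ltW.
have TrT : Tr <= N `^ u * T `^ (r / p).
  apply: (@le_trans _ _ (M `^ ((r - p) / 2) * T)).
    apply: (fun_calc_tau_le pc M0 aM (powR_ge0 _ _) (is_fun_calc_abs_pow pc M0 aM r1)
      (is_fun_calc_abs_pow pc M0 aM p1)) => t tM.
    rewrite (_ : r / 2 = (r - p) / 2 + p / 2); last by field.
    by apply: powR_split_le; rewrite ?divr_ge0 ?divr_gt0 ?subr_ge0 // ltW.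
  have -> : r / p = u + 1 by rewrite /u; field; rewrite gt_eqF.
  have -> : (r - p) / 2 = p / 2 * u by rewrite /u; field; rewrite gt_eqF.
  rewrite powRD ?powRr1 //; last by apply/implyP; lra.
  rewrite mulrA ler_wpM2r // -powRM // powRrM ge0_ler_powR ?nnegrE ?powR_ge0 //.
    by rewrite mulr_ge0.
  exact: opnorm_starmul_powR_le.
apply: (@le_trans _ _ ((N `^ u * T `^ (r / p)) `^ r^-1)).
  by rewrite ge0_ler_powR ?invr_ge0 ?nnegrE ?mulr_ge0 ?powR_ge0 // ltW.
rewrite powRM ?powR_ge0 // -!powRrM.
have -> : u / r = p^-1 - r^-1 by rewrite /u; field; rewrite !gt_eqF.
by rewrite mulrAC divff ?mul1r // gt_eqF.
Qed.

(** The norm of c is at most sqrt M = (M^(p/2))^(1/p). *)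
Lemma opnorm_nikolskii : (opnorm c <= (N `^ p^-1 * T `^ p^-1)%:E)%E.
Proof.
have N0 : 0 <= N by apply: le_trans sN.
apply: le_trans (opnorm_le_sqrt pc M0 aM) _; rewrite lee_fin -powRM //.
have -> : Num.sqrt M = (M `^ (p / 2)) `^ p^-1.
  by rewrite -powRrM mulrAC divff ?gt_eqF // mul1r powR12_sqrt.
rewrite ge0_ler_powR ?invr_ge0 ?nnegrE ?powR_ge0 ?mulr_ge0 ?(ltW p0) //.
exact: opnorm_starmul_powR_le.
Qed.

End Exponent.
End Nikolskii.

(** * Frequencies in a box *)

Section Boxes.
Context {R : realType} {d : nat} (theta : 'M[R]_d).
Local Notation ser := (qseries R d).
Local Notation qmul := (qmul theta).
Local Notation polynomial := Defs.polynomial.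
Local Notation act := (act theta).
Implicit Types (a h : ser) (r : nat).

Definition in_box r a := forall m, a m != 0 -> forall j, (`|m 0%R j| <= r)%N.

Definition box r : seq 'rV[int]_d :=
  [seq \row_j (Posz (f j) - Posz r) | f : {ffun 'I_d -> 'I_(2 * r).+1}].

Lemma box_uniq r : uniq (box r).
Proof.
rewrite map_inj_uniq ?enum_uniq // => f g fg; apply/ffunP => j; apply: val_inj.
have := congr1 (fun m : 'rV[int]_d => m 0 j) fg; rewrite !mxE /=; lia.
Qed.

Lemma size_box r : size (box r) = ((2 * r).+1 ^ d)%N.
Proof. by rewrite size_map -cardE card_ffun !card_ord. Qed.

Lemma in_box_supp r a : in_box r a -> supp_in (box r) a.
Proof.
move=> ra m mr; apply/eqP; apply: contraNT mr => /ra mr.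
pose f := [ffun j => inord (absz (m 0 j + Posz r)%R) : 'I_(2 * r).+1].
apply/mapP; exists f; rewrite ?mem_enum //; apply/rowP => j; rewrite mxE ffunE inordK.
  by have := mr j; move: (m 0 j) => z zr; rewrite gez0_abs; lia.
by have := mr j; move: (m 0 j) => z; lia.
Qed.

Lemma in_box_polynomial r a : in_box r a -> polynomial a.
Proof.
move=> ra; apply/polynomialP; exists (box r); first exact: box_uniq.
exact: in_box_supp.
Qed.

Lemma in_box_star r a : in_box r a -> in_box r (star theta a).
Proof.
move=> ra m; rewrite /star conjC_eq0 mulf_eq0 negb_or => /andP[_ /ra am] j.
by have := am j; rewrite mxE abszN.
Qed.

Lemma in_box_qmul r r' a h :
  in_box r a -> in_box r' h -> in_box (r + r')%N (qmul a h).
Proof.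
move=> ra rh k; rewrite (qmulE _ _ _ (box_uniq r') (in_box_supp rh)) => kn j.
have /hasP[n nr] :
    has (fun n => cocycle theta (k - n) n * a (k - n) * h n != 0) (box r').
  apply: contraNT kn => /hasPn H.
  by rewrite big_seq big1 // => n /H; rewrite negbK => /eqP.
rewrite !mulf_eq0 !negb_or => /andP[/andP[_ /ra/(_ j)]] + /rh/(_ j).
rewrite !mxE; move: (k 0 j) (n 0 j) => x y; lia.
Qed.

Lemma in_box_pow r a k : in_box r a -> in_box (k * r)%N (act a 'X^k (U 0)).
Proof.
move=> ra; have pa := in_box_polynomial ra; elim: k => [|k IH].
  rewrite expr0 act1 => m; rewrite /U pnatr_eq0 eqb0 negbK => /eqP -> j.
  by rewrite mxE.
rewrite exprS act_X //; last exact: polynomialU.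
by rewrite mulSn; exact: in_box_qmul.
Qed.

End Boxes.

(** 1/p as a real number, equal to 0 for p = +oo, so that finite and infinite exponents share one
    formula. *)
Definition inv_exponent (R : realType) (p : \bar R) : R := fine (p^-1)%E.

Lemma Lp_norm_nikolskii (R : realType) (d : nat) (theta : 'M[R]_d)
    (p : R) (p1 : \bar R) :
  1 <= p -> (p%:E < p1)%E ->
  exists2 D : R, 1 <= D & forall (c : qseries R d) r, (0 < r)%N -> in_box r c ->
    (0 <= Lp_norm theta p1 c)%E /\
    exists2 T, 0 <= T & Lp_norm theta p%:E c = T%:E /\
    (Lp_norm theta p1 c <= ((D * r%:R ^+ d) `^ (p^-1 - inv_exponent p1) * T)%:E)%E.
Proof.
(* This j gives p <= 2^j <= 4 2^j. The power a^(2^j) has its frequencies in a box of size 2^j 2r,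
   which has (4 2^j r + 1)^d <= D r^d points as r >= 1. *)
move=> p1' pp1; pose j := Num.truncn p; pose D : R := (4 * 2 ^ j).+1%:R ^+ d.
exists D => [|c r r0 rc]; first by rewrite exprn_ege1 // ler1n.
have pc := in_box_polynomial rc.
have [M M0 aM] := polynomial_opnorm_fin theta (polynomial_starmul theta pc).
pose a := qmul theta (star theta c) c.
have ra : in_box (r + r)%N a by apply: in_box_qmul => //; exact: in_box_star.
have us := box_uniq (d := d) (2 ^ j * (r + r))%N.
have sa := in_box_supp (in_box_pow (theta := theta) (k := (2 ^ j)%N) ra).
have sN : (size (box (d := d) (2 ^ j * (r + r))%N))%:R <= D * r%:R ^+ d :> R.
  rewrite size_box -exprMn natrX lerXn2r ?nnegrE // -natrM ler_nat.
  set x := (2 ^ j)%N; nia.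
have pj : p <= (4 * 2 ^ j)%:R.
  apply: (le_trans (ltW (truncnS_gt p))); rewrite ler_nat -/j.
  by apply: (leq_trans (ltn_expl j (isT : (1 < 2)%N))); rewrite leq_pmull.
have T0 := tau_abs_pow_ge0 pc M0 aM p1'.
split.
  by case: (p1) => [s| |] //=; rewrite ?lee_fin ?powR_ge0 // opnorm_ge0.
exists (complex.Re (tau (abs_pow theta c p)) `^ p^-1); first exact: powR_ge0.
split=> //; case: p1 pp1 => [s| |] //.
  rewrite lte_fin => ps; rewrite /inv_exponent inver gt_eqF /=; last first.
    by apply: lt_trans ps; apply: lt_le_trans p1'.
  rewrite lee_fin; exact: (tau_abs_pow_nikolskii pc M0 aM p1' us sa sN pj).
move=> _; rewrite /inv_exponent invey /= subr0.
exact: (opnorm_nikolskii pc M0 aM p1' us sa sN pj).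
Qed.

Section Blocks.
Context {R : realType} {d : nat} (theta : 'M[R]_d) (phi : 'rV[R]_d -> R).

(** phi is supported in |xi| <= 2, so a frequency m of the block satisfies 2^(-k) |m| <= 2. *)
Lemma in_box_block k (x : qdistribution theta) : dyadic_partition phi ->
  in_box (2 ^ k.+1)%N (block phi k x).
Proof.
move=> [_ suppphi _ _] m; rewrite /block mulf_eq0 negb_or => /andP[+ _] j.
set y := map_mx intr m => dk.
have {}dk : dilate phi k y != 0 by apply: contraNN dk => /eqP ->.
have /suppphi/andP[_] : closure [set xi | phi xi != 0] ((2 : R) ^ (- k%:Z) *: y).
  exact: subset_closure.
rewrite /enorm => H.
have {}H : `|(2 : R) ^ (- k%:Z) * (m 0 j)%:~R| <= 2.
  apply: le_trans H; rewrite -sqrtr_sqr ler_wsqrtr // (bigD1 j) //= !mxE.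
  by rewrite lerDl sumr_ge0 // => i _; rewrite sqr_ge0.
rewrite -(ler_nat R) natrX exprS.
have k0 : 0 < (2 : R) ^+ k by rewrite exprn_gt0.
rewrite -ler_pdivrMr // mulrC; move: H; rewrite normrM gtr0_norm ?exprz_gt0 //.
by rewrite -exprnN natr_absz intr_norm.
Qed.

End Blocks.

(** * The embedding *)

Section SequenceNorm.
Context {R : realType}.
Implicit Types (z A X : R) (F : nat -> R) (G : nat -> \bar R) (q : \bar R).

(** The l^q norm of the sequence z, G 0, G 1, ...; the Besov norm takes this form once its weights
    are absorbed in G. *)
Definition seq_norm q z G : \bar R :=
  match q with
  | s%:E => (((z `^ s)%:E + \sum_(0 <= k <oo) G k `^ s) `^ s^-1)%E
  | +oo%E => maxe z%:E (ereal_sup (range G))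
  | -oo%E => 0%E
  end.

Lemma seq_norm_powR (s : R) z F X : 1 <= s -> (forall k, 0 <= F k) ->
  seq_norm s%:E z (fun k => (F k)%:E) = X%:E ->
  ((z `^ s)%:E + \sum_(0 <= k <oo) (F k `^ s)%:E = (X `^ s)%:E)%E.
Proof.
move=> s1 F0 /= E; have s0 : 0 < s by exact: lt_le_trans s1.
have := congr1 (fun x => x `^ s)%E E; rewrite -poweRrM mulVf ?gt_eqF //.
rewrite poweRe1 // adde_ge0 // ?lee_fin ?powR_ge0 //.
by apply: nneseries_ge0 => k _ _; rewrite lee_fin powR_ge0.
Qed.

Lemma seq_norm_ge q z F X : (1 <= q)%E -> 0 <= z -> (forall k, 0 <= F k) ->
  seq_norm q z (fun k => (F k)%:E) = X%:E ->
  [/\ 0 <= X, z <= X & forall k, F k <= X].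
Proof.
case: q => [s| |] // s1 z0 F0; last first.
  move=> /= E; have zX : z <= X by rewrite -lee_fin -E le_max lexx.
  split=> // [|k]; first exact: le_trans zX.
  by rewrite -lee_fin -E le_max ereal_sup_ubound ?orbT //; exists k.
rewrite lee_fin in s1; have s0 : 0 < s by exact: lt_le_trans s1.
move=> E; have E2 := seq_norm_powR s1 F0 E.
have X0 : 0 <= X by rewrite -lee_fin -E poweR_ge0.
set S := (\sum_(0 <= k <oo) _)%E in E2.
have S0 : (0 <= S)%E by apply: nneseries_ge0 => k _ _; rewrite lee_fin powR_ge0.
have root (y : R) : 0 <= y -> y `^ s <= X `^ s -> y <= X.
  by move=> y0; apply: contraTT; rewrite -!ltNge => Xy; rewrite gt0_ltr_powR.
split=> // [|k]; apply: root => //; rewrite -lee_fin -E2.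
  by rewrite leeDl.
apply: (@le_trans _ _ S); last by rewrite leeDr // lee_fin powR_ge0.
apply: le_trans (nneseries_lim_ge k.+1 _); last first.
  by move=> i _ _; rewrite lee_fin powR_ge0.
by rewrite big_nat_recr //= leeDr // sume_ge0 // => i _; exact: powR_ge0.
Qed.

(** Inclusion of l^q in l^q1: the l^q norm X bounds every entry t, so t^s1 <= X^(s1 - s) t^s, and
    summation gives X^s1. *)
Lemma seq_norm_le q q1 z F G A : (1 <= q)%E -> (q <= q1)%E -> 0 <= z -> 1 <= A ->
  (forall k, 0 <= F k) -> (forall k, 0 <= G k <= (A * F k)%:E)%E ->
  (seq_norm q1 z G <= A%:E * seq_norm q z (fun k => (F k)%:E))%E.
Proof.
move=> q1' qq1 z0 A1 F0 GF; have A0 : 0 <= A by apply: le_trans A1.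
case E : (seq_norm q z _) => [X| |]; last first.
- exfalso; suff : (0 <= seq_norm q z (fun k => (F k)%:E))%E by rewrite E.
  case: q q1' {qq1 E} => [s| |] // _ /=; first exact: poweR_ge0.
  by rewrite le_max lee_fin z0.
- by rewrite gt0_muley ?leey // lte_fin (lt_le_trans _ A1).
have [X0 zX FX] := seq_norm_ge q1' z0 F0 E.
have AX0 : 0 <= A * X by rewrite mulr_ge0.
case: q1 qq1 => [s1| |]; last 2 first.
- move=> _ /=; rewrite -EFinM ge_max lee_fin (le_trans zX) ?ler_peMl //=.
  apply: ge_ereal_sup => _ [k _ <-]; have /andP[_ /le_trans] := GF k; apply.
  by rewrite lee_fin ler_wpM2l.
- by case: q q1' E.
case: q q1' E => [s| |] // s_1; rewrite lee_fin in s_1; move=> E ss1.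
have s0 : 0 < s by exact: lt_le_trans s_1.
rewrite lee_fin in ss1; have s10 : 0 < s1 by exact: lt_le_trans ss1.
pose K := A `^ s1 * X `^ (s1 - s).
have K0 : 0 <= K by rewrite mulr_ge0 // powR_ge0.
have bound (t : R) : 0 <= t <= X -> (A * t) `^ s1 <= K * t `^ s.
  move=> /andP[t0 tX]; rewrite powRM // /K -mulrA ler_wpM2l ?powR_ge0 //.
  rewrite -{1}(subrK s s1); apply: powR_split_le => //; rewrite ?t0 ?subr_ge0 //.
have E2 := seq_norm_powR s_1 F0 E; set S := (\sum_(0 <= k <oo) _)%E in E2.
have S0 : (0 <= S)%E by apply: nneseries_ge0 => k _ _; rewrite lee_fin powR_ge0.
have H : ((z `^ s1)%:E + \sum_(0 <= k <oo) G k `^ s1 <= ((A * X) `^ s1)%:E)%E.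
  apply: (@le_trans _ _ (K%:E * ((z `^ s)%:E + S))%E).
    rewrite ge0_muleDr ?lee_fin ?powR_ge0 //; apply: leeD.
      (* The entry z carries no factor A on the left, and z <= A z because A >= 1. *)
      rewrite -EFinM lee_fin; apply: le_trans (bound z _); last by rewrite z0.
      by rewrite ge0_ler_powR ?nnegrE ?mulr_ge0 ?ler_peMl // ltW.
    rewrite -nneseriesZl //; last by move=> k _; rewrite lee_fin powR_ge0.
    apply: lee_nneseries => [k _ _|k _]; first exact: poweR_ge0.
    have /andP[G0 GAF] := GF k.
    apply: (@le_trans _ _ ((A * F k)%:E `^ s1)%E).
      apply: gt0_ler_poweR; rewrite ?(ltW s10) ?in_itv /= ?G0 ?leey //.
      by rewrite lee_fin mulr_ge0.
    by rewrite poweR_EFin -EFinM lee_fin; apply: bound; rewrite F0 FX.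
  rewrite E2 -EFinM lee_fin powRM // /K -mulrA ler_wpM2l ?powR_ge0 //.
  by rewrite -powRD ?subrK //; apply/implyP => /eqP; lra.
rewrite -EFinM -[X in (_ <= X%:E)%E](powRr1 AX0) -(mulfV (lt0r_neq0 s10)) powRrM.
rewrite -[X in (_ <= X)%E]/(((A * X) `^ s1)%:E `^ s1^-1)%E.
apply: gt0_ler_poweR; rewrite ?invr_ge0 ?(ltW s10) //.
- rewrite in_itv /= leey andbT adde_ge0 ?lee_fin ?powR_ge0 //.
  by apply: nneseries_ge0 => k _ _; exact: poweR_ge0.
- by rewrite in_itv /= leey lee_fin powR_ge0.
Qed.

Lemma eq_seq_norm q z G G' : (forall k, G k = G' k) -> seq_norm q z G = seq_norm q z G'.
Proof. by move=> GG; congr (seq_norm q z _); apply/funext. Qed.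

End SequenceNorm.

Lemma besov_normE (R : realType) (d : nat) (theta : 'M[R]_d)
    (phi : 'rV[R]_d -> R) (alpha : R) (p q : \bar R) (x : qdistribution theta) :
  (1 <= q)%E -> (forall k, (0 <= Lp_norm theta p (block phi k x))%E) ->
  besov_norm theta phi alpha p q x = seq_norm q (Normc.normc (fourier x 0))
    (fun k => ((2 `^ (k%:R * alpha))%:E * Lp_norm theta p (block phi k x))%E).
Proof.
case: q => [s| |] // s1 L0; rewrite /besov_norm /=; congr ((_ + _) `^ _)%E.
apply: eq_eseriesr => k _; rewrite poweRM ?lee_fin ?powR_ge0 //.
by rewrite poweR_EFin -powRrM -mulrA mulrC.
Qed.

Theorem theorem7p2 (R : realType) (d : nat) (hd : (2 <= d)%N)
    (theta : 'M[R]_d) (skew : theta^T = - theta)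
    (phi : 'rV[R]_d -> R) (hphi : dyadic_partition phi)
    (p p1 q q1 : \bar R) (alpha alpha1 : R)
    (hp : (1 <= p)%E) (hpp1 : (p < p1)%E) (hp1 : (p1 <= +oo)%E)
    (hq : (1 <= q)%E) (hqq1 : (q <= q1)%E) (hq1 : (q1 <= +oo)%E)
    (halpha : (alpha%:E - d%:R%:E / p = alpha1%:E - d%:R%:E / p1)%E) :
  besov theta phi alpha p q `<=` besov theta phi alpha1 p1 q1 /\
  exists C : R, forall x, besov theta phi alpha p q x ->
    (besov_norm theta phi alpha1 p1 q1 x <=
     C%:E * besov_norm theta phi alpha p q x)%E.
Proof.
(* p is finite because p < p1. *)
case: p hp hpp1 halpha => [p| |] //; last by move=> _; rewrite ltNge leey.
rewrite lee_fin => hp hpp1 halpha; have p0 : 0 < p by exact: lt_le_trans hp.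
have [alphaE w0] : alpha = alpha1 + d%:R * (p^-1 - inv_exponent p1) /\
    0 <= p^-1 - inv_exponent p1.
  rewrite /inv_exponent; move: halpha; rewrite inver gt_eqF //.
  case: p1 {hp1} hpp1 => [s| |] //.
    rewrite lte_fin => ps; have s0 : 0 < s by exact: lt_trans ps.
    rewrite inver gt_eqF //= => -[E]; split; first lra.
    by rewrite subr_ge0 lef_pV2 ?posrE // ltW.
  move=> _; rewrite invey mule0 sube0 /= subr0 => -[E].
  by split; [lra | rewrite invr_ge0 ltW].
have [D D1 nik] := Lp_norm_nikolskii theta hp hpp1.
set w := p^-1 - _ in alphaE w0 nik.
(* Block k lies in a box of size 2^(k+1), so its Nikolskii constant is (D 2^((k+1) d))^w = A 2^(k d
   w); the second factor is the ratio of the weights 2^(k alpha) and 2^(k alpha1). *)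
pose A := (D * 2 ^+ d) `^ w.
have A1 : 1 <= A.
  have DD : 1 <= D * 2 ^+ d by rewrite mulr_ege1 // exprn_ege1 // ler1n.
  apply: (@le_trans _ _ (1 `^ w)); first by rewrite powR1.
  by rewrite ge0_ler_powR ?nnegrE // (le_trans _ DD).
have D0 : 0 <= D by apply: le_trans D1.
have scale k : (D * (2 ^ k.+1)%:R ^+ d) `^ w = A * 2 `^ (k%:R * (d%:R * w)) :> R.
  rewrite /A mulrA powRrM -powRM ?powR_ge0 ?mulr_ge0 ?exprn_ge0 //.
  by rewrite -natrM powR_mulrn // natrX -exprM mulSn exprD mulrA.
suff H x : (besov_norm theta phi alpha1 p1 q1 x <=
    A%:E * besov_norm theta phi alpha p%:E q x)%E.
  split=> [x xB|]; last by exists A => x _; exact: H.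
  by apply: le_lt_trans (H x) _; rewrite lte_mul_pinfty ?lee_fin ?(le_trans ler01).
have r0 k : (0 < 2 ^ k.+1)%N by rewrite expn_gt0.
have nikx k := nik _ _ (r0 k) (@in_box_block _ _ _ _ k x hphi).
have q1' : (1 <= q1)%E by exact: le_trans hqq1.
rewrite !besov_normE //; last 2 first.
- by move=> k; have [_ [T T0 [-> _]]] := nikx k.
- by move=> k; have [] := nikx k.
(* The L_p norms of the blocks are finite, so the sequence on the right is real, as [seq_norm_le]
   demands. *)
rewrite [in leRHS](@eq_seq_norm _ _ _ _ (fun k =>
    (2 `^ (k%:R * alpha) * fine (Lp_norm theta p%:E (block phi k x)))%:E)); last first.
  by move=> k; have [_ [T T0 [-> _]]] := nikx k.
apply: seq_norm_le => // [|k|k].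
- by case: (fourier x 0) => u v; rewrite sqrtr_ge0.
- by have [_ [T T0 [-> _]]] := nikx k; rewrite mulr_ge0 // powR_ge0.
have [L0 [T T0 [-> LT]]] := nikx k.
rewrite mule_ge0 ?lee_fin ?powR_ge0 //=.
apply: (le_trans (lee_wpmul2l _ LT)); first by rewrite lee_fin powR_ge0.
rewrite -EFinM lee_fin scale alphaE (mulrDr k%:R alpha1) powRD; last first.
  by rewrite pnatr_eq0 implybT.
by rewrite le_eqVlt; apply/orP; left; apply/eqP; ring.
Qed.
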